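(* Let $Y\subset\mathbb{P}^3$ be the discriminant of the projection $\pi_L$ of a cubic hypersurface $X\subset\mathbb{P}^{k+4}$ from a linear subspace $L\subset X$ of dimension $k$ (hence $\deg(Y)=k+4$), and let $A(x)$ be the associated symmetric matrix. Assume that the singular points of $Y$ are nodes, that is, they have quadratic part of rank $3$. (1) If $L\cap\mathrm{Sing}(X)=\emptyset$, then there is a bijection between the sets $\mathrm{Sing}(X)$ and $\mathrm{Sing}(Y)\cap\{x\mid\mathrm{corank}(A(x))=1\}$, induced by the projection $\pi_L$. (2) If $k\le1$, then $L\cap\mathrm{Sing}(X)=\emptyset$, so (1) holds automatically. (3) If $k=2$, then there is a surjection $\mathrm{Sing}(Y)\cap\{x\mid\mathrm{corank}(A(x))=1\}\to\mathrm{Sing}(X)$ such that the inverse image of each point in $L\cap\mathrm{Sing}(X)$ consists of two such nodes. In this case, the singularities of $X$ are all nodes.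
   Context: Everything is over $\mathbb{C}$. Choose coordinates $(z_0,\dots,z_k,x_0,\dots,x_3)$ on $\mathbb{P}^{k+4}$ with $L=\{x=0\}$. Since $L\subset X$, the equation of $X$ is $\sum_{i,j=0}^ka_{ij}(x)z_iz_j+2\sum_{i=0}^kq_i(x)z_i+G(x)=0$ with $a_{ij}=a_{ji},q_i,G$ homogeneous polynomials of degrees $1,2,3$ in $x$. $A(x)$ is the symmetric $(k+2)\times(k+2)$ matrix with upper left block $(a_{ij}(x))_{0\le i,j\le k}$ and last row and column $(q_0(x),\dots,q_k(x),G(x))$. The projection $\pi_L$ is $(z,x)\mapsto x\in\mathbb{P}^3$ and the discriminant is the surface $Y=\{x\in\mathbb{P}^3\mid\det A(x)=0\}$. *)

(* Defs.v *)
From mathcomp Require Export all_boot all_order all_algebra.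
From mathcomp Require Export boolp classical_sets functions reals.
From mathcomp.real_closed Require Export complex.
From mathcomp.multinomials Require Export mpoly.

Set Implicit Arguments.
Unset Strict Implicit.
Unset Printing Implicit Defensive.

Import GRing.Theory.

#[global] Open Scope ring_scope.
#[global] Open Scope classical_set_scope.

(* P^n: the lines through the origin of C^(n+1).  Homogeneous conditions are
   tested on the nonzero representative [rep p]; they do not depend on it. *)
Definition proj (C : fieldType) (n : nat) :=
  {l : {vspace 'rV[C]_n.+1} | \dim l == 1%N}.

Definition rep (C : fieldType) (n : nat) (p : proj C n) : 'rV[C]_n.+1 :=
  vpick (val p).

Lemma dim_line1 (C : fieldType) (n : nat) :
  \dim <[const_mx 1 : 'rV[C]_n.+1]>%VS == 1%N.
Proof.
rewrite dim_vline.
suff /negPf-> : (const_mx 1 : 'rV[C]_n.+1) != 0 by [].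
by apply/eqP => /rowP => /(_ ord0) /eqP; rewrite !mxE oner_eq0.
Qed.

(* The point [v]; for v = 0 this is the irrelevant default [1 : ... : 1]. *)
Definition point (C : fieldType) (n : nat) (v : 'rV[C]_n.+1) : proj C n :=
  insubd (exist _ <[const_mx 1]>%VS (dim_line1 C n) : proj C n) <[v]>%VS.

Definition zeros (C : fieldType) (n : nat) (F : {mpoly C[n.+1]}) :
  set (proj C n) := [set p | F.@[rep p 0] = 0].

Definition Sing (C : fieldType) (n : nat) (F : {mpoly C[n.+1]}) :
  set (proj C n) := [set p | zeros F p /\ forall i, F^`M(i).@[rep p 0] = 0].

(* Equation of F = 0 in the affine chart x_i = 1 of P^n, in the n affine
   coordinates centred at p (meaningful when (rep p) 0 i != 0). *)
Definition local_eqn (C : fieldType) (n : nat) (F : {mpoly C[n.+1]})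
    (p : proj C n) (i : 'I_n.+1) : {mpoly C[n]} :=
  F \mPo [tuple (rep p 0 j / rep p 0 i)%:MP +
                (if unlift i j is Some l then 'X_l else 0) | j < n.+1].

(* The matrix of second derivatives of a quadratic form is twice its Gram
   matrix, so that this is the rank of Q in characteristic 0. *)
Definition qform_rank (C : fieldType) (n : nat) (Q : {mpoly C[n]}) : nat :=
  \rank (\matrix_(l, m) (Q^`M(l))^`M(m)@_0%MM).

Definition is_node (C : fieldType) (n : nat) (F : {mpoly C[n.+1]})
    (p : proj C n) : Prop :=
  Sing F p /\
  exists i, rep p 0 i != 0 /\
    qform_rank (pihomog mdeg 2 (local_eqn F p i)) = n.

Definition corank (C : fieldType) (n : nat) (M : 'M[C]_n) : nat :=
  (n - \rank M)%N.

(* The coordinates of P^(k+4) are (z, x) with z of length k+1, x of length 4. *)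
Definition zvar (C : fieldType) (k : nat) (i : 'I_k.+1) :
  {mpoly C[(k + 4).+1]} := 'X_(lshift 4 i : 'I_(k.+1 + 4)).

Definition of_x (C : fieldType) (k : nat) (f : {mpoly C[4]}) :
  {mpoly C[(k + 4).+1]} :=
  f \mPo [tuple 'X_(rshift k.+1 j : 'I_(k.+1 + 4)) | j < 4].

Definition xcoord (C : fieldType) (k : nat) (v : 'rV[C]_(k + 4).+1) :
  'rV[C]_4 := rsubmx (v : 'rV[C]_(k.+1 + 4)).

Definition Lspace (C : fieldType) (k : nat) : set (proj C (k + 4)) :=
  [set p | xcoord (rep p) = 0].
Arguments Lspace {C} k _.

(* The projection from L; junk value on L. *)
Definition piL (C : fieldType) (k : nat) (p : proj C (k + 4)) : proj C 3 :=
  point (xcoord (rep p)).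
Arguments piL {C} k p.

Definition cubic_eqn (C : fieldType) (k : nat) (a : 'M[{mpoly C[4]}]_k.+1)
    (q : 'rV[{mpoly C[4]}]_k.+1) (G : {mpoly C[4]}) : {mpoly C[(k + 4).+1]} :=
  \sum_(i < k.+1) \sum_(j < k.+1) of_x k (a i j) * zvar C i * zvar C j
  + 2%:R * \sum_(i < k.+1) of_x k (q 0 i) * zvar C i + of_x k G.

Definition Amx (C : fieldType) (k : nat) (a : 'M[{mpoly C[4]}]_k.+1)
    (q : 'rV[{mpoly C[4]}]_k.+1) (G : {mpoly C[4]}) :
  'M[{mpoly C[4]}]_(k.+1 + 1) := block_mx a q^T q G%:M.

Definition discr (C : fieldType) (k : nat) (a : 'M[{mpoly C[4]}]_k.+1)
    (q : 'rV[{mpoly C[4]}]_k.+1) (G : {mpoly C[4]}) : {mpoly C[4]} :=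
  \det (Amx a q G).

Definition corank1 (C : fieldType) (k : nat) (a : 'M[{mpoly C[4]}]_k.+1)
    (q : 'rV[{mpoly C[4]}]_k.+1) (G : {mpoly C[4]}) : set (proj C 3) :=
  [set y | corank (map_mx (meval (rep y 0)) (Amx a q G)) = 1%N].

(* Main.v *)
Require Import Defs.
From mathcomp Require Import zify ring.

Set Implicit Arguments.
Unset Strict Implicit.
Unset Printing Implicit Defensive.

Import Order.TTheory GRing.Theory Num.Theory.

(** Write [n = k+1], [A(x)] for the symmetric matrix and [D = det A]; a point
[w = (z, t)] of the space on which [A(x)] acts is called a kernel vector over
[y] when [A(y) w = 0] and all the numbers [w^T (d_l A)(y) w] vanish (predicate
[singker]).  Everything rests on two computations.

The cubic is [F(z, x) = w^T A(x) w] with [w = (z, 1)].  Differentiating it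
shows that [(z, x)] is a singular vector of [F] exactly when [(z, 1)] is a
kernel vector over [x]; by homogeneity, a kernel vector [(z, t)] over [y] gives
the singular point [(z : t y)] of [X].  This is the map from nodes of [Y] to
[Sing X]; it lands in [L] when [t = 0], and elsewhere it inverts the projection.

Conversely, complete [w] to a basis, so that [A] becomes a block matrix with
corner [g = w^T A w], border [u] and block [B].  The expansion
[det = g det B - u adj(B) u^T] and the fact that [g], [dg] and [u] vanish at [y]
give, up to a nonzero square,

  [Hess D = det B . Hess g - 2 J^T adj(B) J],  [J] the Jacobian of [u]

(lemma [hess_det]).  If [A(y)] had corank at least 2 then [det B = 0], so
[adj B], hence [Hess D], would have rank at most 1.  Since a singular point of
a surface in P^3 is a node exactly when the [4 x 4] Hessian of the equation has
rank 3 (Euler's relation, [is_nodeE]), every kernel vector sits over a point of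
corank 1, where it is unique up to a scalar.  This proves (1).

Let now [(z : 0)] be a singular point of [X] on [L].  Then [z^T a(x) z]
vanishes identically, [a(x) z = N x] for a matrix [N] with [z^T N = 0], and
[(z, 0)] is a kernel vector over the points [y] of the linear space [N y = 0]
with [s(y) = 0], where [s = q . z] is a quadratic form.  For [k <= 2] this
linear space has dimension at least 2, so such a [y] exists.  There [Hess g = 0],
and a node forces the rows of [N] together with [ds(y)] to have rank 3, while
[N] has rank at most [k].  This is impossible for [k <= 1], which is (2).  For
[k = 2] it makes [s] nondegenerate on a 2-dimensional space, so that it has
exactly two zeros up to scalars: these are the two nodes over the point
([two_isotropic], [liftp_fiber]).

Finally, for the nodes of [X]: off [L] the displayed formula says that [Hess D]
is, up to [det a], the Schur complement of the block [2 a] in [Hess F], so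
[rank Hess F = k + 1 + 3]; on [L], [Hess F] is twice the block matrix with
blocks [0, N, N^T, Hess s], whose kernel is the line of [(z, 0)] because [s] is
nondegenerate on [ker N] ([rank_hess_on_L]). *)

(** * Jets of homogeneous polynomials *)
Lemma mpoly_ring_ind (C : comNzRingType) n (P : {mpoly C[n]} -> Prop) :
  (forall c, P c%:MP) -> (forall i, P 'X_i) ->
  (forall f g, P f -> P g -> P (f + g)) ->
  (forall f g, P f -> P g -> P (f * g)) -> forall f, P f.
Proof.
move=> PC PX PD PM f; rewrite [f]mpolyE; apply: (big_ind P (PC 0) PD) => m _.
rewrite -mul_mpolyC; apply: (PM _ _ (PC _)).
rewrite mpolyXE_id; apply: (big_ind P (PC 1) PM) => j _.
by elim: (m j) => [|e IH]; [exact: (PC 1) | rewrite exprS; apply: (PM _ _ (PX j))].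
Qed.

Lemma mderivXU (C : comNzRingType) n (i l : 'I_n) :
  ('X_i : {mpoly C[n]})^`M(l) = (i == l)%:R.
Proof.
rewrite mderivX mnm1E; case: eqP => [->|_]; last by rewrite scale0r.
by rewrite scale1r -{1}[U_(l)%MM]add0m addmK mpolyX0.
Qed.

Section Calculus.
Variables (C : numFieldType) (n : nat).
Implicit Types (f g h : {mpoly C[n]}) (v : 'rV[C]_n).

Definition grad f v : 'rV[C]_n := \row_i f^`M(i).@[v 0].
Definition hess f v : 'M[C]_n := \matrix_(i, j) (f^`M(i))^`M(j).@[v 0].

Lemma hess_sym f v : (hess f v)^T = hess f v.
Proof. by apply/matrixP=> i j; rewrite !mxE mderiv_comm. Qed.

Lemma meval_homog d f (c : C) v : f \is d.-homog ->
  f.@[(c *: v) 0] = c ^+ d * f.@[v 0].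
Proof.
move=> /dhomogP fd; rewrite !mevalE mulr_sumr.
apply: eq_big_seq => m /fd <- /=.
rewrite mulrCA; congr (_ * _); rewrite mdegE -prodrXr -big_split /=.
by apply: eq_bigr => i _; rewrite mxE exprMn.
Qed.

Lemma meval0_homog d f : f \is d.-homog -> (0 < d)%N ->
  f.@[(0 : 'rV[C]_n) 0] = 0.
Proof.
by move=> fd d0; rewrite -(scale0r 0) (meval_homog _ _ fd) expr0n gtn_eqF // mul0r.
Qed.

Lemma dhomog_mderiv d f i : f \is d.-homog -> f^`M(i) \is d.-1.-homog.
Proof.
move=> /dhomogP fd; apply/dhomogP => m.
rewrite mcoeff_msupp mcoeff_deriv => fm.
have /fd <- : (m + U_(i))%MM \in msupp f.
  by rewrite mcoeff_msupp; apply: contra fm => /eqP ->; rewrite mul0rn.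
by rewrite /= mdegD mdeg1 addn1.
Qed.

Lemma euler d f v : f \is d.-homog ->
  \sum_j v 0 j * f^`M(j).@[v 0] = d%:R * f.@[v 0].
Proof.
move=> fd; suff E : \sum_j 'X_j * f^`M(j) = d%:R *: f.
  rewrite -mevalZ -E raddf_sum; apply: eq_bigr => j _ /=.
  by rewrite mevalM mevalXU.
have /dhomogP fdm := fd.
rewrite [f in RHS]mpolyE scaler_sumr.
transitivity (\sum_(m <- msupp f) \sum_j f@_m *: ('X_j * ('X_[m])^`M(j))).
  rewrite exchange_big; apply: eq_bigr => j _ /=.
  rewrite [f in LHS]mpolyE linear_sum mulr_sumr; apply: eq_bigr => m _ /=.
  by rewrite mderivZ scalerAr.
apply: eq_big_seq => m /fdm /= <-.
rewrite mdegE natr_sum scaler_suml; apply: eq_bigr => j _.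
rewrite mderivX -scalerAr -mpolyXD scalerA mulrC -scalerA.
have [->|mj] := eqVneq (m j) 0%N; first by rewrite !scale0r.
congr (_ *: (_ *: 'X_[_])); rewrite addmC submK //; apply/mnm_lepP => l.
by rewrite mnm1E; case: eqP => // <-; rewrite lt0n.
Qed.

Lemma euler_grad d f v : f \is d.-homog ->
  v *m (grad f v)^T = (d%:R * f.@[v 0])%:M.
Proof.
move=> fd; apply/matrixP => i j; rewrite !ord1 !mxE eqxx -(euler v fd).
by apply: eq_bigr => l _; rewrite !mxE.
Qed.

Lemma euler_hess d f v : f \is d.-homog ->
  v *m hess f v = d.-1%:R *: grad f v.
Proof.
move=> fd; apply/rowP => i; rewrite !mxE -(euler v (dhomog_mderiv i fd)).
by apply: eq_bigr => j _; rewrite !mxE mderiv_comm.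
Qed.

Lemma gradZ d f c v : f \is d.-homog -> grad f (c *: v) = c ^+ d.-1 *: grad f v.
Proof.
by move=> fd; apply/rowP => i; rewrite !mxE (meval_homog _ _ (dhomog_mderiv i fd)).
Qed.

Lemma hessZ d f c v : f \is d.-homog -> hess f (c *: v) = c ^+ d.-2 *: hess f v.
Proof.
move=> fd; apply/matrixP => i j; rewrite !mxE.
by rewrite (meval_homog _ _ (dhomog_mderiv j (dhomog_mderiv i fd))).
Qed.

Lemma mderivM_at f g v i : f.@[v 0] = 0 ->
  (f * g)^`M(i).@[v 0] = f^`M(i).@[v 0] * g.@[v 0].
Proof. by move=> f0; rewrite mderivM mevalD !mevalM f0 mul0r addr0. Qed.

Lemma mderiv2M_at f g v i j : f.@[v 0] = 0 -> grad f v = 0 ->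
  (f * g)^`M(i)^`M(j).@[v 0] = f^`M(i)^`M(j).@[v 0] * g.@[v 0].
Proof.
move=> f0 /rowP g0; have fi l := g0 l; have {}fi l : f^`M(l).@[v 0] = 0.
  by have := fi l; rewrite !mxE.
by rewrite !(mderivM, mderivD) !(mevalD, mevalM) f0 !fi !(mul0r, addr0).
Qed.

(** The product of two functions vanishing at a point and a third one: only the
terms in which each vanishing factor is differentiated once survive. *)
Lemma mderiv2MM_at f g h v i j : f.@[v 0] = 0 -> h.@[v 0] = 0 ->
  (f * g * h)^`M(i)^`M(j).@[v 0] =
  f^`M(i).@[v 0] * g.@[v 0] * h^`M(j).@[v 0]
  + f^`M(j).@[v 0] * g.@[v 0] * h^`M(i).@[v 0].
Proof.
move=> f0 h0; rewrite !(mderivM, mderivD) !(mevalD, mevalM) f0 h0.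
by rewrite !(mul0r, mulr0, addr0, add0r) addrC.
Qed.

Definition singv f v : Prop := f.@[v 0] = 0 /\ grad f v = 0.

Lemma singvZ d f c v : f \is d.-homog -> c != 0 -> singv f (c *: v) <-> singv f v.
Proof.
move=> fd c0; rewrite /singv (meval_homog _ _ fd) (gradZ _ _ fd).
have ce e : c ^+ e == 0 = false by rewrite expf_eq0 (negPf c0) andbF.
split=> -[/eqP + /eqP].
  by rewrite mulf_eq0 scaler_eq0 !ce /= => /eqP -> /eqP ->.
by move=> /eqP -> /eqP ->; rewrite mulr0 scaler0.
Qed.

End Calculus.

(** * Points, singular points and nodes in projective space *)
Section Projective.
Variables (C : numFieldType) (n : nat).
Implicit Types (p : proj C n) (v : 'rV[C]_n.+1).

Lemma rep_neq0 p : rep p != 0.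
Proof.
rewrite vpick0; apply/eqP => p0; have := svalP p; rewrite /= -/(val p) p0.
by rewrite dimv0.
Qed.

Lemma val_point v : v != 0 -> val (point v) = <[v]>%VS.
Proof. by move=> v0; rewrite /point val_insubd dim_vline v0. Qed.

Lemma rep_point v : v != 0 -> exists2 c, c != 0 & rep (point v) = c *: v.
Proof.
move=> v0; have := memv_pick (val (point v)); rewrite -/(rep _) val_point //.
move=> /vlineP[c rc]; exists c => //; apply: contra_neq (rep_neq0 (point v)) => c0.
by rewrite rc c0 scale0r.
Qed.

Lemma pointZ c v : c != 0 -> point (c *: v) = point v.
Proof.
move=> c0; rewrite /point; congr insubd; apply/vspaceP => x.
apply/vlineP/vlineP => -[d ->]; first by exists (d * c); rewrite scalerA.
by exists (d / c); rewrite scalerA divfK.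
Qed.

Lemma repK p : point (rep p) = p.
Proof.
apply: val_inj; rewrite val_point ?rep_neq0 //; apply/eqP.
by rewrite eqEdim -memvE memv_pick dim_vline rep_neq0 (eqP (svalP p)).
Qed.

Lemma point_inj v w : v != 0 -> w != 0 -> point v = point w ->
  exists2 c, c != 0 & v = c *: w.
Proof.
move=> v0 w0 vw; have [c c0 rv] := rep_point v0; have [d d0] := rep_point w0.
rewrite -vw rv => cd; exists (c^-1 * d); first by rewrite mulf_neq0 ?invr_eq0.
by rewrite -scalerA -cd scalerA mulVf // scale1r.
Qed.

Lemma SingE (F : {mpoly C[n.+1]}) p : Sing F p <-> singv F (rep p).
Proof.
split=> -[F0 g0]; split=> //; first by apply/rowP => i; rewrite !mxE.
by move=> i; move/rowP: g0 => /(_ i); rewrite !mxE.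
Qed.

Lemma Sing_point d (F : {mpoly C[n.+1]}) v : F \is d.-homog -> v != 0 ->
  Sing F (point v) <-> singv F v.
Proof.
move=> Fd v0; have [c c0 rc] := rep_point v0.
by rewrite SingE rc; apply: singvZ Fd c0.
Qed.

End Projective.

Section LocalEquation.
Variables (C : numFieldType) (n : nat).

(** The chain rule for the substitution that defines an affine chart; the slot
[i] is a constant and slot [lift i l] moves with unit speed in the variable
[l]. *)
Lemma mderiv_comp_affine (F : {mpoly C[n.+1]}) (i : 'I_n.+1) (c : 'I_n.+1 -> C)
    (l : 'I_n) :
  let t := [tuple (c j)%:MP + (if unlift i j is Some m then 'X_m else 0)
             | j < n.+1] in
  (F \mPo t)^`M(l) = F^`M(lift i l) \mPo t.
Proof.
move=> t; elim/mpoly_ring_ind: F => [a|j|f g hf hg|f g hf hg].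
- by rewrite comp_mpolyC !mderivC comp_mpoly0.
- rewrite comp_mpolyXU -tnth_nth tnth_mktuple mderivD mderivC add0r mderivXU.
  case: unliftP => [m ->|->].
    by rewrite mderivXU (inj_eq (@lift_inj _ i)) rmorph_nat.
  by rewrite mderiv0 (negPf (neq_lift i l)) comp_mpoly0.
- by rewrite comp_mpolyD !mderivD comp_mpolyD hf hg.
- by rewrite rmorphM /= !mderivM rmorphD !rmorphM /= hf hg.
Qed.

Lemma mcoeff_pihomog d (f : {mpoly C[n]}) m :
  (pihomog mdeg d f)@_m = f@_m *+ (mdeg m == d).
Proof.
rewrite pihomogE raddf_sum big_mkcond [f in RHS]mpolyE raddf_sum -sumrMnl.
apply: eq_bigr => k _ /=; rewrite mcoeffZ mcoeffX.
have [->|km] := eqVneq k m; first by case: ifP; rewrite ?mulr0n ?mulr1n.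
by rewrite mulr0 mul0rn if_same.
Qed.

Lemma meval0_mcoeff (f : {mpoly C[n]}) : f.@[fun=> 0] = f@_0%MM.
Proof.
rewrite [f in LHS]mpolyE [f in RHS]mpolyE !raddf_sum; apply: eq_bigr => m _ /=.
rewrite mevalZ mevalX mcoeffZ mcoeffX; congr (_ * _).
have [->|m0] := eqVneq m 0%MM; first by apply: big1 => i _; rewrite mnm0E.
have [i mi] : exists i, m i != 0%N.
  apply/existsP; apply: contra_neqT m0 => /existsPn m0; apply/mnmP => i.
  by rewrite mnm0E; apply/eqP/negPn.
by rewrite (bigD1 i) //= expr0n (negPf mi) mul0r.
Qed.

Lemma hess_local_eqn (F : {mpoly C[n.+1]}) (p : proj C n) (i : 'I_n.+1) :
  \matrix_(l, m) ((pihomog mdeg 2 (local_eqn F p i))^`M(l))^`M(m)@_0%MM =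
  mxsub (lift i) (lift i) (hess F ((rep p 0 i)^-1 *: rep p)).
Proof.
apply/matrixP => l m; rewrite !mxE !mcoeff_deriv add0m mcoeff_pihomog.
rewrite mdegD !mdeg1 eqxx mulr1n.
transitivity ((local_eqn F p i)^`M(l)^`M(m)@_0%MM).
  by rewrite !mcoeff_deriv add0m.
rewrite -meval0_mcoeff !mderiv_comp_affine comp_mpoly_meval.
apply: meval_eq => j; rewrite tnth_mktuple mevalD mevalC mxE mulrC.
by case: unlift => [k|]; rewrite ?mevalXU ?meval0 addr0.
Qed.

End LocalEquation.

Section Nodes.
Variables (C : numFieldType) (n : nat).

(** A kernel vector with nonzero [i]th entry expresses row [i] through the other
rows, and by symmetry column [i] through the other columns. *)
Lemma rank_mxsub_lift (H : 'M[C]_n.+1) (v : 'rV[C]_n.+1) i :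
  H^T = H -> v *m H = 0 -> v 0 i != 0 ->
  \rank (mxsub (lift i) (lift i) H) = \rank H.
Proof.
have rk m (B : 'M[C]_(n.+1, m)) : v *m B = 0 -> v 0 i != 0 ->
    \rank (rowsub (lift i) B) = \rank B.
  move=> vB vi; apply/eqP; rewrite eqn_leq !mxrankS ?rowsub_sub //.
  apply/row_subP => j; case: (unliftP i j) => [l ->|->].
    by rewrite -row_rowsub row_sub.
  have /rowP vB' := vB.
  suff -> : row i B = - (v 0 i)^-1 *: \sum_l v 0 (lift i l) *: row l (rowsub (lift i) B).
    by rewrite scalemx_sub // summx_sub // => l _; rewrite scalemx_sub // row_sub.
  apply/rowP => c; have := vB' c; rewrite !mxE (bigD1_ord i) //= => /eqP.
  rewrite addr_eq0 => /eqP vBc; rewrite summxE.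
  have -> : \sum_l (v 0 (lift i l) *: row l (rowsub (lift i) B)) 0 c =
      \sum_l v 0 (lift i l) * B (lift i l) c.
    by apply: eq_bigr => l _; rewrite !mxE.
  by apply: (mulfI vi); rewrite vBc mulNr mulrN mulVKf.
move=> Hs vH vi; rewrite mxsubrc rk //.
  by rewrite -mxrank_tr trmx_mxsub rk // Hs.
rewrite mulmx_colsub vH.
by apply/matrixP => ? ?; rewrite !mxE.
Qed.

(** At a singular point Euler's relation puts the point itself in the kernel of
the Hessian of the homogeneous equation, and the Hessian of a local equation is
the restriction to a complement of that line; hence the two ranks agree and the
choice of the chart does not matter. *)
Lemma is_nodeE d (F : {mpoly C[n.+1]}) p : F \is d.-homog ->
  is_node F p <-> singv F (rep p) /\ \rank (hess F (rep p)) = n.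
Proof.
move=> Fd; rewrite -SingE.
suff rkE i : Sing F p -> rep p 0 i != 0 ->
    qform_rank (pihomog mdeg 2 (local_eqn F p i)) = \rank (hess F (rep p)).
  split=> [[Sp [i [pi rk]]]|[Sp rk]]; first by split=> //; apply: etrans rk; rewrite rkE.
  split=> //; have [i pi] : exists i, rep p 0 i != 0 by apply/rV0Pn/rep_neq0.
  by exists i; rewrite rkE.
move=> /SingE [_ gp] pi; rewrite /qform_rank hess_local_eqn (hessZ _ _ Fd).
have c0 : (rep p 0 i)^-1 ^+ d.-2 != 0 by rewrite expf_neq0 // invr_eq0.
rewrite (@rank_mxsub_lift _ (rep p)) ?mxrank_scale_nz //.
  by rewrite linearZ /= hess_sym.
by rewrite -scalemxAr (euler_hess _ Fd) gp !scaler0.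
Qed.

End Nodes.

(** * Linear algebra *)

(** When [det B] is regular, multiply on the right by the block matrix with rows
[1, - adj(B) v] and [0, det B], which clears the border [v], take determinants
and cancel [det B].  The
general case is specialized from [B + X], whose determinant is monic in [X],
at [X = 0]. *)
Lemma det_bordered (R : comNzRingType) n (B : 'M[R]_n) (v : 'cV_n) (u : 'rV_n) (g : R) :
  \det (block_mx B v u g%:M) = g * \det B - (u *m \adj B *m v) 0 0.
Proof.
have reg (S : comNzRingType) (B' : 'M[S]_n) (v' : 'cV_n) (u' : 'rV_n) g' :
    GRing.lreg (\det B') ->
    \det (block_mx B' v' u' g'%:M) = g' * \det B' - (u' *m \adj B' *m v') 0 0.
  move=> dreg; apply: dreg; set d := \det B'.
  have : block_mx B' v' u' g'%:M *m block_mx 1%:M (- (\adj B' *m v')) 0 d%:M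
      = block_mx B' 0 u' (g' * d - (u' *m \adj B' *m v') 0 0)%:M.
    rewrite mulmx_block !mulmx1 !mulmx0 !addr0 !mulmxN; congr block_mx.
      by rewrite mulmxA mul_mx_adj scalar_mxC addNr.
    rewrite mulmxA -scalar_mxM addrC raddfB /=; congr (_ - _).
    exact: mx11_scalar.
  move=> /(congr1 determinant); rewrite det_mulmx det_ublock det1 mul1r.
  by rewrite !det_lblock !det_scalar1 mulrC.
(* [char_poly_mx (- B)] is the matrix [X + B]. *)
pose B1 := char_poly_mx (- B).
have eB : map_mx (horner_eval 0) B1 = B.
  apply/matrixP => i j; rewrite !mxE /horner_eval !hornerE.
  by rewrite hornerMn hornerX mul0rn sub0r opprK.
have eC m p (M : 'M[R]_(m, p)) : map_mx (horner_eval 0) (map_mx polyC M) = M.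
  by apply/matrixP => i j; rewrite !mxE /horner_eval hornerC.
have := reg _ B1 (map_mx polyC v) (map_mx polyC u) g%:P.
move=> /(_ (monic_lreg (char_poly_monic _))) /(congr1 (horner_eval 0)).
rewrite -det_map_mx map_block_mx eB !eC map_scalar_mx rmorphB rmorphM /= -det_map_mx eB.
have -> : horner_eval 0 g%:P = g by rewrite /horner_eval hornerC.
move=> ->; congr (_ - _).
transitivity (map_mx (horner_eval 0) (map_mx polyC u *m \adj B1 *m map_mx polyC v) 0 0).
  by rewrite [RHS]mxE.
by rewrite !map_mxM /= map_mx_adj eB !eC.
Qed.

(** If [B] has corank 1, [adj B] is killed by [B] and so has rank at most 1; if
the corank is larger, all the cofactors vanish. *)
Lemma rank_adj_le1 (F : fieldType) n (B : 'M[F]_n) :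
  \det B = 0 -> (\rank (\adj B) <= 1)%N.
Proof.
move=> dB; have [rB|rB] := leqP n.-1 (\rank B).
  have : (\adj B <= kermx B)%MS by apply/sub_kermxP; rewrite mul_adj_mx dB raddf0.
  by move/mxrankS; rewrite mxrank_ker => /leq_trans; apply; lia.
suff -> : \adj B = 0 by rewrite mxrank0.
apply/matrixP => i j; rewrite !mxE /cofactor.
suff -> : \det (row' j (col' i B)) = 0 by rewrite mulr0.
apply/eqP/negPn; rewrite -unitfE -unitmxE -row_free_unit /row_free neq_ltn.
apply/orP; left; apply: leq_ltn_trans rB.
rewrite row'Esub; apply: leq_trans (mxrankS (rowsub_sub _ _)) _.
by rewrite col'Esub -mxrank_tr trmx_mxsub -(mxrank_tr B) mxrankS // rowsub_sub.
Qed.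

Lemma complete_row (F : fieldType) n (w : 'rV[F]_(n + 1)) : w != 0 ->
  exists T : 'M_(n, n + 1), col_mx T w \in unitmx.
Proof.
move=> w0; have rw : \rank (w^C)%MS = n by rewrite mxrank_compl rank_rV w0 addnK.
have: exists T : 'M_(n, n + 1), (T :=: w^C)%MS.
  exists (castmx (rw, erefl) (row_base w^C)%MS).
  exact: eqmx_trans (eqmx_cast _ _) (eq_row_base _).
move=> [T eT]; exists T; rewrite -row_full_unit -sub1mx -addsmxE.
by rewrite (adds_eqmx eT (eqmx_refl _)) addsmxC sub1mx addsmx_compl_full.
Qed.

Lemma ker_line (F : fieldType) n (M : 'M[F]_(n + 1)) (v w : 'rV_(n + 1)) :
  \rank M = n -> w != 0 -> w *m M = 0 -> v *m M = 0 -> exists c, v = c *: w.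
Proof.
move=> rM w0 /sub_kermxP wM /sub_kermxP vM; apply/sub_rVP.
apply: submx_trans vM _; rewrite -(geq_leqif (mxrank_leqif_sup wM)).
by rewrite mxrank_ker rM rank_rV w0 addKn.
Qed.

(** Symmetric block elimination turns the matrix into the block diagonal one
with blocks [P] and its Schur complement. *)
Lemma rank_schur (F : fieldType) m n (P : 'M[F]_m) (L : 'M_(m, n)) (H : 'M_n) :
  P \in unitmx -> P^T = P ->
  \rank (block_mx P L L^T H) = (m + \rank (H - L^T *m invmx P *m L)%R)%N.
Proof.
move=> uP sP; pose U := block_mx 1%:M (- (invmx P *m L)) 0 (1%:M : 'M_n).
have uU : U \in unitmx by rewrite unitmxE det_ublock !det1 mul1r unitr1.
have tX : (- (invmx P *m L))^T = - (L^T *m invmx P).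
  by rewrite raddfN /= trmx_mul trmx_inv sP.
have E : U^T *m block_mx P L L^T H *m U
   = block_mx P 0 0 (H - L^T *m invmx P *m L).
  rewrite tr_block_mx tX !trmx1 trmx0 !mulmx_block !mul1mx !mulmx1 !mul0mx !mulmx0.
  rewrite !addr0 !mulNmx !mulmxN mulmxKV // mulmxA mulmxV // mul1mx !addNr.
  by rewrite mul0mx oppr0 add0r addrC.
have rP : \rank P = m by apply/eqP; rewrite -/(row_free P) row_free_unit.
set S := H - _ in E *.
transitivity (\rank (block_mx P 0 0 S)); last by rewrite rank_diag_block_mx rP.
rewrite -E mxrankMfree ?row_free_unit //.
by rewrite -[RHS]mxrank_tr trmx_mul trmxK mxrankMfree ?mxrank_tr // row_free_unit.
Qed.

Lemma sub_adds_row (F : fieldType) n (u v w : 'rV[F]_n) :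
  (w <= u + v)%MS -> exists a b, w = a *: u + b *: v.
Proof.
move=> /sub_addsmxP[[x y] /= ->]; exists (x 0 0), (y 0 0).
by rewrite {1}[x]mx11_scalar {1}[y]mx11_scalar !mul_scalar_mx.
Qed.

Lemma exists_row_notin (F : fieldType) m n (K : 'M[F]_(m, n)) (b : 'rV_n) :
  (1 < \rank K)%N -> exists2 v : 'rV_n, (v <= K)%MS & ~~ (v <= b)%MS.
Proof.
move=> rK; have /row_subPn[i bi] : ~~ (K <= b)%MS.
  apply: contraL rK => /mxrankS rKb; rewrite -leqNgt.
  by apply: leq_trans rKb _; rewrite rank_rV leq_b1.
by exists (row i K); rewrite ?row_sub.
Qed.

Section Isotropic.
Variables (C : numClosedFieldType) (n : nat) (S : 'M[C]_n).
Hypothesis Ssym : S^T = S.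

Definition bil (x y : 'rV[C]_n) : C := (x *m S *m y^T) 0 0.

Lemma bilC x y : bil x y = bil y x.
Proof.
transitivity ((x *m S *m y^T)^T 0 0); first by rewrite [RHS]mxE.
by rewrite !trmx_mul trmxK Ssym mulmxA.
Qed.

Lemma bilDl x x' y : bil (x + x') y = bil x y + bil x' y.
Proof. by rewrite /bil !mulmxDl mxE. Qed.

Lemma bilZl a x y : bil (a *: x) y = a * bil x y.
Proof. by rewrite /bil -!scalemxAl mxE. Qed.

Lemma bilDr x y y' : bil x (y + y') = bil x y + bil x y'.
Proof. by rewrite bilC bilDl !(bilC x). Qed.

Lemma bilZr a x y : bil x (a *: y) = a * bil x y.
Proof. by rewrite bilC bilZl (bilC x). Qed.

Lemma bil_comb a b x y : bil (a *: x + b *: y) (a *: x + b *: y) =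
  a ^+ 2 * bil x x + 2%:R * a * b * bil x y + b ^+ 2 * bil y y.
Proof.
by rewrite !(bilDl, bilDr, bilZl, bilZr) (bilC y x); ring.
Qed.

(** On a plane spanned by [x] and [y], isotropy of [t x + y] is a quadratic
equation in [t] (or [x] is isotropic already), solvable over an algebraically
closed field. *)
Lemma isotropic_exists m (K : 'M[C]_(m, n)) : (1 < \rank K)%N ->
  exists y : 'rV_n, [/\ y != 0, (y <= K)%MS & bil y y = 0].
Proof.
move=> rK; have [x xK nx] := exists_row_notin 0 rK.
have x0 : x != 0 by apply: contraNneq nx => ->; apply: sub0mx.
have [xx|xx] := eqVneq (bil x x) 0; first by exists x.
have [y yK yx] := exists_row_notin x rK.
pose t := (sqrtC (bil x y ^+ 2 - bil x x * bil y y) - bil x y) / bil x x.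
exists (t *: x + 1 *: y); split.
- apply: contra yx; rewrite scale1r addrC addr_eq0 => /eqP ->.
  by rewrite -scaleNr scalemx_sub.
- by rewrite addmx_sub ?scalemx_sub.
rewrite bil_comb.
have := sqrtCK (bil x y ^+ 2 - bil x x * bil y y).
rewrite /t; set r := sqrtC _ => rr.
apply: (mulfI xx); rewrite mulr0.
transitivity (r ^+ 2 - (bil x y ^+ 2 - bil x x * bil y y)); last by rewrite rr subrr.
by field.
Qed.

End Isotropic.

(** The configuration behind the two nodes over a point of [L].  The kernel [K]
of [N] has dimension at least [4 - k >= 2], so it contains an isotropic [y1];
the rank hypothesis at [y1] leaves no room but [k = 2] and [rank N = 2], and it
forces [y1] to pair nontrivially with the plane [K].  A nondegenerate quadratic
form on a plane with one isotropic line has exactly one other. *)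
Lemma two_isotropic (C : numClosedFieldType) k (z : 'rV[C]_k.+1)
    (N : 'M_(k.+1, 4)) (S : 'M_4) :
  (k <= 2)%N -> S^T = S -> z != 0 -> z *m N = 0 ->
  (forall y : 'rV_4, y != 0 -> y *m N^T = 0 -> bil S y y = 0 ->
     (3 <= \rank (col_mx N (y *m S)))%N) ->
  [/\ k = 2%N, \rank N = 2%N & exists y1 y2 : 'rV_4,
      [/\ y1 != 0 /\ y2 != 0, y1 *m N^T = 0 /\ y2 *m N^T = 0,
          bil S y1 y1 = 0 /\ bil S y2 y2 = 0, bil S y1 y2 != 0 &
          forall y, y *m N^T = 0 -> exists a b, y = a *: y1 + b *: y2]].
Proof.
move=> k2 Ss z0 zN H; pose K := kermx N^T.
have rNk : (\rank N <= k)%N.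
  have : (z <= kermx N)%MS by apply/sub_kermxP.
  by move/mxrankS; rewrite mxrank_ker rank_rV z0; lia.
have rK : \rank K = (4 - \rank N)%N by rewrite mxrank_ker mxrank_tr.
have [|y1 [y10 y1K s1]] := isotropic_exists Ss (K := K); first by rewrite rK; lia.
have y1N : y1 *m N^T = 0 by apply/sub_kermxP.
have r3 := H _ y10 y1N s1.
have rN : \rank N = 2%N.
  have : (\rank (col_mx N (y1 *m S)) <= \rank N + \rank (y1 *m S))%N.
    by rewrite -addsmxE mxrank_adds_leqif.
  have r1 : (\rank (y1 *m S) <= 1)%N := rank_leq_row _.
  move: r3 r1; move: (\rank (y1 *m S)) (\rank (col_mx N _)) => r s; lia.
have {}k2 : k = 2%N by lia.
have [|b bK by1] := @exists_row_notin _ _ _ K y1; first by rewrite rK rN.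
have bN : b *m N^T = 0 by apply/sub_kermxP.
have spanK : (K <= y1 + b)%MS.
  have sK : (y1 + b <= K)%MS by rewrite addsmx_sub y1K.
  rewrite -(geq_leqif (mxrank_leqif_sup sK)) rK rN.
  have : (y1 < y1 + b)%MS.
    by rewrite /ltmx addsmxSl addsmx_sub submx_refl.
  by rewrite ltmxErank => /andP[_]; rewrite rank_rV y10.
have be : bil S y1 b != 0.
  apply/eqP => be.
  have : (K <= kermx (col_mx N (y1 *m S))^T)%MS.
    apply: submx_trans spanK _; rewrite addsmx_sub.
    apply/andP; split; apply/sub_kermxP; rewrite tr_col_mx mul_mx_row ?y1N ?bN;
      apply/eqP; rewrite row_mx_eq0 eqxx /= trmx_mul Ss mulmxA [_ *m _]mx11_scalar.
      by rewrite -/(bil S y1 y1) s1 raddf0.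
    by rewrite -/(bil S b y1) bilC // be raddf0.
  move/mxrankS; rewrite rK rN mxrank_ker mxrank_tr.
  by move: r3; move: (\rank _) => r; lia.
(* The second root of the form on the plane spanned by [y1] and [b]: up to a
   scalar, the reflection of [y1] in the hyperplane orthogonal to [b], or [b]
   itself when [b] is isotropic. *)
pose y2 := bil S b b *: y1 + (- (2%:R * bil S y1 b)) *: b.
have s2 : bil S y2 y2 = 0 by rewrite /y2 bil_comb // s1; ring.
have s12 : bil S y1 y2 = - (2%:R * bil S y1 b ^+ 2).
  by rewrite bilDr // !bilZr // s1; ring.
have be2 : 2%:R * bil S y1 b != 0 by rewrite mulf_neq0 // pnatr_eq0.
have n12 : bil S y1 y2 != 0.
  by rewrite s12 oppr_eq0 mulf_neq0 ?pnatr_eq0 // expf_neq0.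
split=> //; exists y1, y2; split=> //.
- split=> //; apply: contraNneq n12 => ->.
  by rewrite /bil trmx0 mulmx0 mxE.
- by split=> //; rewrite /y2 mulmxDl -!scalemxAl y1N bN !scaler0 addr0.
move=> y /sub_kermxP yK.
have [a [c ->]] := sub_adds_row (submx_trans yK spanK).
exists (a + c * bil S b b / (2%:R * bil S y1 b)), (- c / (2%:R * bil S y1 b)).
rewrite /y2 scalerDr !scalerA addrA -scalerDl; congr (_ *: _ + _ *: _); field => //.
Qed.

(** * The Hessian of a symmetric determinant at a kernel vector *)
Notation "A @@ y" := (map_mx (meval (fun_of_matrix y 0)) A) (at level 30).
Notation dmx l A := (map_mx (mderiv l) A).
Notation cmx A := (map_mx (@mpolyC _ _) A).

Section BigSums.
Variables (C : numFieldType) (m : nat) (I : finType) (F : I -> {mpoly C[m]}).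

Lemma meval_sum v : (\sum_i F i).@[v] = \sum_i (F i).@[v].
Proof. exact: (raddf_sum (meval v)). Qed.

Lemma mderiv_sum l : (\sum_i F i)^`M(l) = \sum_i (F i)^`M(l).
Proof. exact: (raddf_sum (mderiv l)). Qed.

End BigSums.

Section Jets.
Variables (C : numFieldType) (m n : nat).
Implicit Types (A : 'M[{mpoly C[m]}]_n) (w : 'rV[C]_n) (y : 'rV[C]_m).

(** The Jacobian at [y] of the vector [A w] with [w] held fixed. *)
Definition kerjac A w y : 'M[C]_(n, m) :=
  \matrix_(i, l) (dmx l A @@ y *m w^T) i 0.
(** The Hessian at [y] of the function [w A w^T] with [w] held fixed. *)
Definition kerhess A w y : 'M[C]_m :=
  \matrix_(i, j) (w *m (dmx j (dmx i A)) @@ y *m w^T) 0 0.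
(** The second condition is that the differential of the function [w A w^T]
vanishes at [y].  When [y] has corank 1 it says that [det A] is singular there;
for [w = (z, 1)] it says that the cubic is singular at [(z, y)]. *)
Definition singker A w y : Prop := w *m A @@ y = 0 /\ w *m kerjac A w y = 0.

Lemma meval_congr p r (P : 'M_(p, n)) (Q : 'M_(r, n)) A y :
  (cmx P *m A *m (cmx Q)^T) @@ y = P *m A @@ y *m Q^T.
Proof.
rewrite !map_mxM; congr (_ *m _ *m _);
  by apply/matrixP => i j; rewrite !mxE /= mevalC.
Qed.

Lemma mderiv_congr p r (P : 'M_(p, n)) (Q : 'M_(r, n)) A l :
  dmx l (cmx P *m A *m (cmx Q)^T) = cmx P *m dmx l A *m (cmx Q)^T.
Proof.
apply/matrixP => i j; rewrite !mxE raddf_sum; apply: eq_bigr => b _ /=.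
rewrite !mxE mulrC mderiv_mulC mulrC raddf_sum; congr (_ * _).
by apply: eq_bigr => a _ /=; rewrite !mxE mderiv_mulC.
Qed.
Lemma singker_scale A (c : C) w y : c != 0 -> singker A w y -> singker A (c *: w) y.
Proof.
move=> c0 [wA wJ].
have E : kerjac A (c *: w) y = c *: kerjac A w y.
  by apply/matrixP => i l; rewrite [LHS]mxE linearZ /= -scalemxAr !mxE.
by split; rewrite ?E -scalemxAl ?wA -?scalemxAr ?wJ !scaler0.
Qed.

End Jets.

Section BorderedDet.
Variables (C : numFieldType) (m n : nat).
Variables (A : 'M[{mpoly C[m]}]_(n + 1)) (y : 'rV[C]_m).
Variables (T : 'M[C]_(n, n + 1)) (w : 'rV[C]_(n + 1)).
Hypotheses (Asym : A^T = A) (wA : w *m A @@ y = 0).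

Let Q := col_mx T w.
Let B := T *m A @@ y *m T^T.
Let J := T *m kerjac A w y.

Lemma eval_sym (X : 'M[{mpoly C[m]}]_(n + 1)) : X^T = X -> (X @@ y)^T = X @@ y.
Proof. by move=> Xs; rewrite map_trmx Xs. Qed.

Lemma ker_row_col : A @@ y *m w^T = 0.
Proof. by rewrite -[RHS]trmx0 -wA trmx_mul eval_sym. Qed.

Let B' := cmx T *m A *m (cmx T)^T.
Let u' := cmx w *m A *m (cmx T)^T.
Let v' := cmx T *m A *m (cmx w)^T.
Let g' := (cmx w *m A *m (cmx w)^T) 0 0.

(** The determinant of [A] in a basis whose last vector is [w], expanded along
the border. *)
Lemma det_congr : (\det Q ^+ 2)%:MP * \det A =
  g' * \det B' - \sum_j \sum_i u' 0 i * \adj B' i j * v' j 0.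
Proof.
transitivity (\det (cmx Q *m A *m (cmx Q)^T)).
  by rewrite !det_mulmx det_tr det_map_mx mulrAC -expr2 rmorphXn.
rewrite map_col_mx tr_col_mx mul_col_mx mul_col_row (mx11_scalar (cmx w *m A *m _)).
rewrite det_bordered; congr (_ - _); rewrite mxE; apply: eq_bigr => j _.
by rewrite mxE mulr_suml.
Qed.

Lemma eval_block : B' @@ y = B. Proof. exact: meval_congr. Qed.

Lemma eval_det_block : (\det B').@[y 0] = \det B.
Proof. by rewrite -eval_block -det_map_mx. Qed.

Lemma eval_adj_block i j : (\adj B' i j).@[y 0] = \adj B i j.
Proof. by rewrite -eval_block -map_mx_adj [RHS]mxE. Qed.

Lemma eval_border_row i : (u' 0 i).@[y 0] = 0.
Proof.
have /matrixP /(_ 0 i) := meval_congr w T A y.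
by rewrite wA mul0mx [in RHS]mxE => <-; rewrite [RHS]mxE.
Qed.

Lemma eval_border_col i : (v' i 0).@[y 0] = 0.
Proof.
have /matrixP /(_ i 0) := meval_congr T w A y.
by rewrite -[T *m _ *m _]mulmxA ker_row_col mulmx0 [in RHS]mxE => <-; rewrite [RHS]mxE.
Qed.

Lemma eval_corner : g'.@[y 0] = 0.
Proof.
have /matrixP /(_ 0 0) := meval_congr w w A y.
by rewrite wA mul0mx [in RHS]mxE => <-; rewrite [RHS]mxE.
Qed.

Lemma deriv_border_col l i : (v' i 0)^`M(l).@[y 0] = J i l.
Proof.
transitivity ((dmx l v' @@ y) i 0); first by rewrite !mxE.
rewrite mderiv_congr meval_congr /J -mulmxA !mxE.
by apply: eq_bigr => k _; rewrite !mxE.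
Qed.

Lemma deriv_border_row l i : (u' 0 i)^`M(l).@[y 0] = J i l.
Proof.
rewrite -deriv_border_col; congr (meval _ (mderiv _ _)).
by rewrite -[v']trmxK [RHS]mxE /v' !trmx_mul !trmxK Asym mulmxA.
Qed.

Lemma deriv_corner l : g'^`M(l).@[y 0] = (w *m kerjac A w y) 0 l.
Proof.
transitivity ((dmx l (cmx w *m A *m (cmx w)^T) @@ y) 0 0).
  by rewrite [RHS]mxE; congr meval; rewrite [RHS]mxE.
rewrite mderiv_congr meval_congr -mulmxA !mxE.
by apply: eq_bigr => k _; rewrite !mxE.
Qed.

Lemma deriv2_corner l k : (g'^`M(l))^`M(k).@[y 0] = kerhess A w y l k.
Proof.
transitivity ((dmx k (dmx l (cmx w *m A *m (cmx w)^T)) @@ y) 0 0).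
  by rewrite [RHS]mxE; congr meval; rewrite [RHS]mxE; congr mderiv; rewrite [RHS]mxE.
by rewrite !mderiv_congr meval_congr [RHS]mxE.
Qed.

Lemma det_at_kernel : (\det Q) ^+ 2 * (\det A).@[y 0] = 0.
Proof.
rewrite -[\det Q ^+ 2](mevalC (y 0)) -mevalM det_congr mevalB mevalM eval_corner mul0r sub0r.
rewrite meval_sum big1 ?oppr0 // => j _; rewrite meval_sum big1 // => i _.
by rewrite mevalM eval_border_col mulr0.
Qed.

(** The border vanishes at [y], so its contribution has order 2; only the corner
is differentiated. *)
Lemma grad_det : (\det Q) ^+ 2 *: grad (\det A) y = \det B *: (w *m kerjac A w y).
Proof.
apply/rowP => l; rewrite [LHS]mxE [grad _ _ _ _]mxE [RHS]mxE -deriv_corner -eval_det_block.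
rewrite -[\det Q ^+ 2](mevalC (y 0)) -mevalM -mderiv_mulC det_congr.
rewrite mderivB mevalB mderivM_at ?eval_corner // [RHS]mulrC.
rewrite mderiv_sum [X in _ - X]meval_sum [X in _ - X]big1 ?subr0 // => j _.
rewrite mderiv_sum meval_sum big1 // => i _.
by rewrite mderivM_at ?mevalM ?eval_border_row ?eval_border_col ?mul0r ?mulr0.
Qed.

(** To second order the corner contributes its Hessian times [det B], and the
quadratic term in the border contributes the product of its first-order
parts. *)
Lemma hess_det : w *m kerjac A w y = 0 ->
  (\det Q) ^+ 2 *: hess (\det A) y =
  \det B *: kerhess A w y - 2%:R *: (J^T *m \adj B *m J).
Proof.
move=> wJ; have adjs : (\adj B)^T = \adj B.
  by rewrite trmx_adj /B !trmx_mul trmxK eval_sym // mulmxA.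
have E l k : \sum_j \sum_i J i l * \adj B i j * J j k = (J^T *m \adj B *m J) l k.
  rewrite !mxE; apply: eq_bigr => j _; rewrite !mxE mulr_suml.
  by apply: eq_bigr => i _; rewrite !mxE.
have Es : (J^T *m \adj B *m J)^T = J^T *m \adj B *m J.
  by rewrite trmx_mul [X in _ *m X]trmx_mul trmxK adjs mulmxA.
have combE (a b : C) (X Y : 'M_m) l k : (a *: X - b *: Y) l k = a * X l k - b * Y l k.
  by rewrite !mxE.
apply/matrixP => l k; rewrite [LHS]mxE [hess _ _ _ _]mxE.
rewrite -[\det Q ^+ 2](mevalC (y 0)) -mevalM -!mderiv_mulC det_congr.
rewrite !mderivB mevalB mderiv2M_at ?eval_corner //; last first.
  by apply/rowP => i; rewrite [LHS]mxE deriv_corner wJ !mxE.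
rewrite deriv2_corner eval_det_block combE mulrC; congr (_ - _).
transitivity ((J^T *m \adj B *m J) l k + (J^T *m \adj B *m J)^T l k).
  rewrite [_^T l k]mxE -!E -big_split /= !mderiv_sum meval_sum; apply: eq_bigr => j _.
  rewrite -big_split /= !mderiv_sum meval_sum; apply: eq_bigr => i _.
  rewrite mderiv2MM_at ?eval_border_row ?eval_border_col //.
  by rewrite eval_adj_block !deriv_border_row !deriv_border_col.
by rewrite Es -mulr2n mulr_natl.
Qed.

End BorderedDet.

Section KernelPoints.
Variables (C : numFieldType) (m n : nat).
Variables (A : 'M[{mpoly C[m]}]_(n + 1)) (y : 'rV[C]_m) (w : 'rV[C]_(n + 1)).
Hypotheses (Asym : A^T = A) (w0 : w != 0).

Lemma singker_sing : singker A w y -> singv (\det A) y.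
Proof.
move=> [wA wJ]; have [T uQ] := complete_row w0.
have dQ : \det (col_mx T w) ^+ 2 != 0 by rewrite expf_neq0 // -unitfE -unitmxE.
split; apply/eqP.
  by have /eqP := det_at_kernel T Asym wA; rewrite mulf_eq0 (negPf dQ).
have /eqP := grad_det T Asym wA.
by rewrite wJ scaler0 scaler_eq0 (negPf dQ).
Qed.

Lemma rank_congr T : w *m A @@ y = 0 -> col_mx T w \in unitmx ->
  \rank (A @@ y) = \rank (T *m A @@ y *m T^T).
Proof.
move=> wA uQ.
have -> : \rank (A @@ y) = \rank (col_mx T w *m A @@ y *m (col_mx T w)^T).
  rewrite mxrankMfree; last by rewrite row_free_unit unitmx_tr.
  by rewrite -[RHS]mxrank_tr trmx_mul mxrankMfree ?mxrank_tr // row_free_unit unitmx_tr.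
rewrite tr_col_mx mul_col_mx mul_col_row wA !mul0mx -(mulmxA T _ w^T) ker_row_col // mulmx0.
by rewrite rank_diag_block_mx mxrank0 addn0.
Qed.

(** If the corank were at least 2, the block [B] complementary to [w] would be
singular, and the Hessian would be a congruence of [adj B], of rank at most
1. *)
Lemma singker_rank : singker A w y -> (1 < \rank (hess (\det A) y))%N ->
  \rank (A @@ y) = n.
Proof.
move=> [wA wJ] rH; have [T uQ] := complete_row w0.
have dQ : \det (col_mx T w) ^+ 2 != 0 by rewrite expf_neq0 // -unitfE -unitmxE.
rewrite (rank_congr wA uQ); apply/eqP; rewrite -/(row_free _) row_free_unit.
rewrite unitmxE unitfE; apply: contraTneq rH => dB.
rewrite -(mxrank_scale_nz _ dQ) (hess_det T Asym wA wJ) dB scale0r sub0r -leqNgt.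
rewrite mxrank_opp mxrank_scale_nz ?pnatr_eq0 //.
apply: leq_trans (mxrankM_maxl _ _) _; apply: leq_trans (mxrankM_maxr _ _) _.
exact: rank_adj_le1.
Qed.

(** Without the corner term, the Hessian factors through the Jacobian. *)
Lemma singker_rank_jac : singker A w y -> kerhess A w y = 0 ->
  (\rank (hess (\det A) y) <= \rank (kerjac A w y))%N.
Proof.
move=> [wA wJ] h0; have [T uQ] := complete_row w0.
have dQ : \det (col_mx T w) ^+ 2 != 0 by rewrite expf_neq0 // -unitfE -unitmxE.
rewrite -(mxrank_scale_nz _ dQ) (hess_det T Asym wA wJ) h0 scaler0 sub0r.
rewrite mxrank_opp mxrank_scale_nz ?pnatr_eq0 //.
by apply: leq_trans (mxrankM_maxr _ _) _; apply: mxrankM_maxr.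
Qed.

(** In corank 1, [det B] is nonzero, so [grad_det] can be read backwards. *)
Lemma sing_singker : \rank (A @@ y) = n -> singv (\det A) y ->
  w *m A @@ y = 0 -> singker A w y.
Proof.
move=> rA [_ gD] wA; split=> //; have [T uQ] := complete_row w0.
have dB : \det (T *m A @@ y *m T^T) != 0.
  by rewrite -unitfE -unitmxE -row_free_unit /row_free -(rank_congr wA uQ) rA.
have /esym/eqP := grad_det T Asym wA.
by rewrite gD scaler0 scaler_eq0 (negPf dB) => /eqP.
Qed.

End KernelPoints.

(** * The cubic and its derivatives *)
Lemma mderiv_double (C : numClosedFieldType) n (f : {mpoly C[n]}) l :
  (2%:R * f)^`M(l) = 2%:R * f^`M(l).
Proof. by rewrite !mulr_natl mderivMn. Qed.

Lemma meval_double (C : numClosedFieldType) n (f : {mpoly C[n]}) v :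
  (2%:R * f).@[v] = 2%:R * f.@[v].
Proof. by rewrite !mulr_natl mevalMn. Qed.

Section OfX.
Variables (C : numClosedFieldType) (k : nat).

(** [zi] and [xi] index the two groups of variables in the type in which the
cubic lives.  That type is only convertible to the one in which the block
lemmas for row vectors and matrices are stated, whence the restatements
below. *)
Definition zi (l : 'I_k.+1) : 'I_(k + 4).+1 := lshift 4 l.
Definition xi (m : 'I_4) : 'I_(k + 4).+1 := rshift k.+1 m.

Lemma xi_neq_zi m l : (xi m == zi l) = false.
Proof. by rewrite -val_eqE /=; have := ltn_ord l; lia. Qed.

Lemma zi_neq_xi l m : (zi l == xi m) = false.
Proof. by rewrite -val_eqE /=; have := ltn_ord l; lia. Qed.

Lemma eq_xi m m' : (xi m == xi m') = (m == m').
Proof. by rewrite -val_eqE /= eqn_add2l. Qed.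

Lemma eq_zi l l' : (zi l == zi l') = (l == l').
Proof. by rewrite -val_eqE. Qed.

Variant zx_spec : 'I_(k + 4).+1 -> Prop :=
  | ZxZ l : zx_spec (zi l)
  | ZxX m : zx_spec (xi m).

Lemma zxP i : zx_spec i.
Proof. by case: (@split_ordP k.+1 4 i) => l ->; constructor. Qed.

Lemma row_zi (u : 'rV[C]_k.+1) (x : 'rV_4) l :
  (row_mx u x : 'rV_(k + 4).+1) 0 (zi l) = u 0 l.
Proof. exact: row_mxEl. Qed.

Lemma row_xi (u : 'rV[C]_k.+1) (x : 'rV_4) m :
  (row_mx u x : 'rV_(k + 4).+1) 0 (xi m) = x 0 m.
Proof. exact: row_mxEr. Qed.

Lemma row_zx_eq (u v : 'rV[C]_(k + 4).+1) :
  (forall l, u 0 (zi l) = v 0 (zi l)) -> (forall m, u 0 (xi m) = v 0 (xi m)) ->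
  u = v.
Proof. by move=> uz ux; apply/rowP => i; case: (zxP i). Qed.

Lemma row_zx_eq0 (u : 'rV[C]_k.+1) (x : 'rV_4) :
  (row_mx u x : 'rV_(k + 4).+1) = 0 <-> u = 0 /\ x = 0.
Proof.
split=> [/rowP ux|[-> ->]].
  2: by apply: row_zx_eq => i; rewrite ?row_zi ?row_xi !mxE.
split; apply/rowP => i; first by have := ux (zi i); rewrite row_zi !mxE.
by have := ux (xi i); rewrite row_xi !mxE.
Qed.

Section Blocks.
Variables (P : 'M[C]_k.+1) (Q : 'M[C]_(k.+1, 4)) (R : 'M[C]_(4, k.+1)) (S : 'M[C]_4).
Let M : 'M_((k + 4).+1) := block_mx P Q R S.

Lemma block_zz l l' : M (zi l) (zi l') = P l l'. Proof. exact: block_mxEul. Qed.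
Lemma block_zx l m : M (zi l) (xi m) = Q l m. Proof. exact: block_mxEur. Qed.
Lemma block_xz m l : M (xi m) (zi l) = R m l. Proof. exact: block_mxEdl. Qed.
Lemma block_xx m m' : M (xi m) (xi m') = S m m'. Proof. exact: block_mxEdr. Qed.
End Blocks.

Lemma of_xX j : of_x k ('X_j : {mpoly C[4]}) = 'X_(xi j).
Proof. by rewrite /of_x comp_mpolyXU -tnth_nth tnth_mktuple. Qed.

Lemma mderiv_of_x_z l (f : {mpoly C[4]}) : (of_x k f)^`M(zi l) = 0.
Proof.
elim/mpoly_ring_ind: f => [c|j|f g hf hg|f g hf hg].
- by rewrite /of_x comp_mpolyC mderivC.
- by rewrite of_xX mderivXU xi_neq_zi.
- by rewrite /of_x comp_mpolyD mderivD [X in X + _]hf [X in _ + X]hg addr0.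
- by rewrite /of_x rmorphM /= mderivM -/(of_x k f) -/(of_x k g) hf hg mul0r mulr0 addr0.
Qed.

Lemma mderiv_of_x_x m (f : {mpoly C[4]}) : (of_x k f)^`M(xi m) = of_x k f^`M(m).
Proof.
elim/mpoly_ring_ind: f => [c|j|f g hf hg|f g hf hg].
- by rewrite /of_x comp_mpolyC !mderivC comp_mpoly0.
- by rewrite of_xX !mderivXU eq_xi /of_x rmorph_nat.
- by rewrite /of_x comp_mpolyD !mderivD comp_mpolyD; congr (_ + _).
- by rewrite /of_x rmorphM /= !mderivM rmorphD !rmorphM /=; congr (_ * _ + _ * _).
Qed.

Lemma meval_of_x (f : {mpoly C[4]}) (z : 'rV_k.+1) (x : 'rV_4) :
  (of_x k f).@[(row_mx z x : 'rV_(k + 4).+1) 0] = f.@[x 0].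
Proof.
rewrite /of_x comp_mpoly_meval; apply: meval_eq => j.
by rewrite tnth_mktuple mevalXU; exact: row_mxEr.
Qed.

(** The vector [w = (z, 1)] as a vector of polynomials: the cubic is the
quadratic form of [A] in it. *)
Definition wvar (i : 'I_(k.+1 + 1)) : {mpoly C[(k + 4).+1]} :=
  if fintype.split i is inl l then zvar C l else 1.

Lemma wvar_l l : wvar (lshift 1 l) = zvar C l.
Proof. by rewrite /wvar (unsplitK (inl l)). Qed.

Lemma wvar_r l : wvar (rshift k.+1 l) = 1.
Proof. by rewrite /wvar (unsplitK (inr l)). Qed.

Lemma meval_wvar i (z : 'rV_k.+1) (x : 'rV_4) :
  (wvar i).@[(row_mx z x : 'rV_(k + 4).+1) 0] = (row_mx z 1%:M) 0 i.
Proof.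
case: (split_ordP i) => l ->; last by rewrite wvar_r row_mxEr meval1 ord1 mxE.
by rewrite wvar_l row_mxEl mevalXU; exact: row_mxEl.
Qed.

Lemma mderiv_wvar_z i l : (wvar i)^`M(zi l) = (i == lshift 1 l)%:R.
Proof.
case: (split_ordP i) => m ->; last by rewrite wvar_r -mpolyC1 mderivC eq_rlshift.
by rewrite wvar_l mderivXU -/(zi m) eq_zi (inj_eq (@lshift_inj _ _)).
Qed.

Lemma mderiv_wvar_x i l : (wvar i)^`M(xi l) = 0.
Proof.
case: (split_ordP i) => m ->; last by rewrite wvar_r -mpolyC1 mderivC.
by rewrite wvar_l mderivXU -/(zi m) zi_neq_xi.
Qed.

End OfX.

Section Cubic.
Variables (C : numClosedFieldType) (k : nat).
Variables (a : 'M[{mpoly C[4]}]_k.+1) (q : 'rV[{mpoly C[4]}]_k.+1) (G : {mpoly C[4]}).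
Hypothesis ha_sym : forall i j, a i j = a j i.

Let A := Amx a q G.
Let F := cubic_eqn a q G.

Lemma Amx_sym : A^T = A.
Proof.
rewrite /A /Amx tr_block_mx trmxK tr_scalar_mx; congr block_mx.
by apply/matrixP => i j; rewrite mxE.
Qed.

Lemma Amx_sym_entry i j : A i j = A j i.
Proof. by rewrite -{1}Amx_sym mxE. Qed.

Lemma cubicE : F = \sum_i \sum_j of_x k (A i j) * wvar C i * wvar C j.
Proof.
rewrite big_split_ord /= big_ord1 big_split_ord /= big_ord1.
rewrite /A /Amx block_mxEdr !wvar_r mxE !mulr1.
under eq_bigr => i _.
  rewrite big_split_ord /= big_ord1 block_mxEur wvar_r wvar_l mulr1 mxE.
  under eq_bigr => j _ do rewrite block_mxEul wvar_l.
  over.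
under [X in _ = _ + (X + _)]eq_bigr => j _ do rewrite block_mxEdl wvar_l mulr1.
by rewrite big_split /F /cubic_eqn /= mulr_natl mulr2n !addrA.
Qed.

(** Symmetry of [A] merges the two terms of the product rule. *)
Lemma mderiv_cubic_z l : F^`M(zi l) = 2%:R * \sum_j of_x k (A (lshift 1 l) j) * wvar C j.
Proof.
rewrite cubicE mderiv_sum.
transitivity (\sum_i ((i == lshift 1 l)%:R * \sum_j of_x k (A i j) * wvar C j)
   + \sum_i of_x k (A i (lshift 1 l)) * wvar C i).
  rewrite -big_split; apply: eq_bigr => i _ /=; rewrite mderiv_sum mulr_sumr.
  rewrite [X in _ = _ + X](_ : _ = \sum_j
      of_x k (A i j) * wvar C i * (j == lshift 1 l)%:R); last first.
    rewrite (bigD1 (lshift 1 l)) //= eqxx mulr1 big1 ?addr0 // => j /negPf ->.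
    by rewrite mulr0.
  rewrite -big_split; apply: eq_bigr => j _ /=.
  by rewrite !mderivM mderiv_of_x_z !mderiv_wvar_z; ring.
rewrite mulr_natl mulr2n; congr (_ + _).
  by rewrite (bigD1 (lshift 1 l)) //= eqxx mul1r [X in _ + X]big1 ?addr0 // => j /negPf ->;
    rewrite mul0r.
by apply: eq_bigr => i _; rewrite Amx_sym_entry.
Qed.

Lemma mderiv_cubic_x m : F^`M(xi k m) =
  \sum_i \sum_j of_x k (A i j)^`M(m) * wvar C i * wvar C j.
Proof.
rewrite cubicE mderiv_sum; apply: eq_bigr => i _; rewrite mderiv_sum.
apply: eq_bigr => j _; rewrite !mderivM mderiv_of_x_x !mderiv_wvar_x; ring.
Qed.

Lemma mderiv2_cubic_zz l l' : F^`M(zi l)^`M(zi l') = 2%:R * of_x k (a l l').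
Proof.
rewrite mderiv_cubic_z mderiv_double mderiv_sum; congr (_ * _).
rewrite (bigD1 (lshift 1 l')) //= big1 ?addr0 => [|j /negPf jl].
  by rewrite mderivM mderiv_of_x_z mderiv_wvar_z eqxx block_mxEul mul0r mulr1 add0r.
by rewrite mderivM mderiv_of_x_z mderiv_wvar_z jl mul0r mulr0 addr0.
Qed.

Lemma mderiv2_cubic_zx l m : F^`M(zi l)^`M(xi k m) =
  2%:R * \sum_j of_x k (A (lshift 1 l) j)^`M(m) * wvar C j.
Proof.
rewrite mderiv_cubic_z mderiv_double mderiv_sum; congr (_ * _).
by apply: eq_bigr => j _; rewrite mderivM mderiv_of_x_x mderiv_wvar_x; ring.
Qed.

Lemma mderiv2_cubic_xx m m' : F^`M(xi k m)^`M(xi k m') =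
  \sum_i \sum_j of_x k (A i j)^`M(m)^`M(m') * wvar C i * wvar C j.
Proof.
rewrite mderiv_cubic_x mderiv_sum; apply: eq_bigr => i _; rewrite mderiv_sum.
apply: eq_bigr => j _; rewrite !mderivM mderiv_of_x_x !mderiv_wvar_x; ring.
Qed.

Section At.
Variables (z : 'rV[C]_k.+1) (x : 'rV[C]_4).
Let v : 'rV_(k + 4).+1 := row_mx z x.
Let w : 'rV_(k.+1 + 1) := row_mx z 1%:M.

Lemma meval_lin (M : 'M[{mpoly C[4]}]_(k.+1 + 1)) i :
  (\sum_j of_x k (M i j) * wvar C j).@[v 0] = (M @@ x *m w^T) i 0.
Proof.
rewrite meval_sum mxE; apply: eq_bigr => j _.
by rewrite mevalM meval_of_x meval_wvar !mxE.
Qed.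

Lemma meval_quad (M : 'M[{mpoly C[4]}]_(k.+1 + 1)) :
  (\sum_i \sum_j of_x k (M i j) * wvar C i * wvar C j).@[v 0] =
  (w *m M @@ x *m w^T) 0 0.
Proof.
rewrite meval_sum -mulmxA mxE; apply: eq_bigr => i _.
rewrite -meval_lin !meval_sum mulr_sumr; apply: eq_bigr => j _.
by rewrite !mevalM meval_of_x !meval_wvar; ring.
Qed.

Lemma cubic_at : F.@[v 0] = (w *m A @@ x *m w^T) 0 0.
Proof. by rewrite cubicE meval_quad. Qed.

Lemma grad_cubic : grad F v =
  row_mx (2%:R *: lsubmx (w *m A @@ x)) (w *m kerjac A w x).
Proof.
apply: row_zx_eq => l.
  rewrite row_zi [LHS]mxE mderiv_cubic_z meval_double.
  rewrite [RHS]mxE meval_lin; congr (_ * _); rewrite [RHS]mxE.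
  transitivity ((w *m A @@ x)^T (lshift 1 l) 0); last by rewrite mxE.
  by rewrite trmx_mul map_trmx Amx_sym.
rewrite row_xi [LHS]mxE mderiv_cubic_x.
have -> : (w *m kerjac A w x) 0 l = (w *m (dmx l A @@ x *m w^T)) 0 0.
  by rewrite !mxE; apply: eq_bigr => i0 _; rewrite !mxE.
rewrite mulmxA -(meval_quad (dmx l A)); apply: (congr1 (meval _)).
by do 2![apply: eq_bigr => ? _]; rewrite [dmx _ _ _ _]mxE.
Qed.

Lemma hess_cubic : hess F v =
  block_mx (2%:R *: a @@ x) (2%:R *: usubmx (kerjac A w x))
           (2%:R *: usubmx (kerjac A w x))^T (kerhess A w x).
Proof.
have zx l m : hess F v (zi l) (xi k m) = (2%:R *: usubmx (kerjac A w x)) l m.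
  rewrite [LHS]mxE mderiv2_cubic_zx meval_double [RHS]mxE; congr (_ * _).
  rewrite [RHS]mxE [RHS]mxE -meval_lin; congr meval.
  by apply: eq_bigr => j _; rewrite [dmx _ _ _ _]mxE.
apply/matrixP => i j; case: (zxP i) => l; case: (zxP j) => m.
- by rewrite block_zz [LHS]mxE mderiv2_cubic_zz meval_double meval_of_x !mxE.
- by rewrite block_zx -zx.
- by rewrite block_xz [RHS]mxE -zx -[in LHS]hess_sym [LHS]mxE.
rewrite block_xx [LHS]mxE mderiv2_cubic_xx [RHS]mxE -(meval_quad (dmx m (dmx l A))).
apply: (congr1 (meval _)); do 2![apply: eq_bigr => ? _].
by rewrite [dmx m _ _ _]mxE [dmx _ _ _ _]mxE.
Qed.

(** The [z]-gradient gives all entries of [w A] but the last; the last one is then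
the value of [F], because the last entry of [w] is 1. *)
Lemma singv_cubic : singv F v <-> singker A w x.
Proof.
rewrite /singv /singker cubic_at grad_cubic row_zx_eq0.
split=> [[F0 [/eqP + ->]]|[-> ->]]; last by rewrite mul0mx mxE linear0 scaler0.
rewrite scaler_eq0 pnatr_eq0 /= => /eqP wl; split=> //.
move: F0; rewrite -[w *m A @@ x]hsubmxK wl /w tr_row_mx mul_row_col.
rewrite mul0mx add0r trmx1 mulmx1 => r0.
by rewrite [rsubmx _]mx11_scalar r0 raddf0 row_mx0.
Qed.

End At.
End Cubic.

(** * Kernel vectors with last entry 0 *)
Lemma dhomog_bigprod (R : idomainType) n (I : finType) (f : I -> {mpoly R[n]}) (e : I -> nat) :
  (forall i, f i \is (e i).-homog) -> \prod_i f i \is (\sum_i e i)%N.-homog.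
Proof.
move=> fe; elim/big_rec2: _ => [|i d p _ pd]; first exact: dhomog1.
by apply: dhomogM.
Qed.

Section HomogCubic.
Variables (C : numClosedFieldType) (k : nat).
Variables (a : 'M[{mpoly C[4]}]_k.+1) (q : 'rV[{mpoly C[4]}]_k.+1) (G : {mpoly C[4]}).
Hypothesis ha : forall i j, a i j \is 1.-homog.
Hypothesis ha_sym : forall i j, a i j = a j i.
Hypothesis hq : forall i, q 0 i \is 2.-homog.
Hypothesis hG : G \is 3.-homog.

Let A := Amx a q G.
Let F := cubic_eqn a q G.

(** The entry [(i, j)] of [A] has degree [1 + e i + e j] with [e = 1] on the last
index and [e = 0] elsewhere, so each term of the determinant has degree
[(k + 2) + 1 + 1]. *)
Lemma discr_homog : discr a q G \is (k + 4).-homog.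
Proof.
pose e (i : 'I_(k.+1 + 1)) : nat := if fintype.split i is inl _ then 0%N else 1%N.
have el i : e (lshift 1 i) = 0%N by rewrite /e (unsplitK (inl i)).
have er i : e (rshift k.+1 i) = 1%N by rewrite /e (unsplitK (inr i)).
have Ae i j : A i j \is (1 + e i + e j).-homog.
  rewrite /A /Amx; case: (split_ordP i) => l ->; case: (split_ordP j) => m ->;
    rewrite ?el ?er ?block_mxEul ?block_mxEur ?block_mxEdl ?block_mxEdr ?mxE ?ord1 //.
rewrite /discr /determinant; apply: rpred_sum => s _.
have se : (\sum_i e i = 1)%N.
  by rewrite big_split_ord big_ord1 /= er big1 // => i _; rewrite el.
have -> : (k + 4 = \sum_i (1 + e i + e (perm.fun_of_perm s i)))%N.
  rewrite !big_split /= se -(reindex_inj perm.perm_inj (P := predT)) /= se.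
  by rewrite sum1_card card_ord; lia.
have hp := dhomog_bigprod (fun i => Ae i (perm.fun_of_perm s i)).
by rewrite mulr_sign; case: ifP => _; rewrite ?rpredN.
Qed.

(** The matrix of the linear map [y |-> a(y) z]; the evaluation point 0 is
immaterial, the derivatives of [a] being constants. *)
Definition Nmx (z : 'rV[C]_k.+1) : 'M[C]_(k.+1, 4) :=
  \matrix_(i, l) (dmx l a @@ (0 : 'rV_4) *m z^T) i 0.
Definition qdot (z : 'rV[C]_k.+1) : {mpoly C[4]} := \sum_j q 0 j * (z 0 j)%:MP.
Definition Smx z : 'M[C]_4 := hess (qdot z) 0.

Lemma qdot_homog z : qdot z \is 2.-homog.
Proof.
by apply: rpred_sum => j _; rewrite mulrC mul_mpolyC; apply: dhomogZ.
Qed.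

Lemma Smx_sym z : (Smx z)^T = Smx z. Proof. exact: hess_sym. Qed.

Lemma meval_0homog n (f : {mpoly C[n]}) (x y : 'rV_n) :
  f \is 0.-homog -> f.@[x 0] = f.@[y 0].
Proof.
move=> f0; transitivity f.@[(0 : 'rV_n) 0].
  by rewrite -[in RHS](scale0r x) (meval_homog _ _ f0) expr0 mul1r.
by rewrite -(scale0r y) (meval_homog _ _ f0) expr0 mul1r.
Qed.

Lemma hess_qdot z y : hess (qdot z) y = Smx z.
Proof.
apply/matrixP => i j; rewrite !mxE; apply: meval_0homog.
by apply: (dhomog_mderiv (d := 1)); apply: (dhomog_mderiv (d := 2)); apply: qdot_homog.
Qed.

Lemma grad_qdot z y : grad (qdot z) y = y *m Smx z.
Proof.
by rewrite -(hess_qdot z y) (euler_hess y (qdot_homog z)) scale1r.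
Qed.

Lemma bil_qdot z y : bil (Smx z) y y = 2%:R * (qdot z).@[y 0].
Proof.
rewrite /bil -grad_qdot -[X in _ *m X]trmxK.
have /matrixP /(_ 0 0) := euler_grad y (qdot_homog z).
rewrite [in RHS]mxE mulr1n => <-.
transitivity ((grad (qdot z) y *m y^T)^T 0 0); first by rewrite trmxK [RHS]mxE.
by rewrite trmx_mul trmxK.
Qed.

Lemma dmx_qdot z l (y : 'rV[C]_4) : (dmx l q @@ y *m z^T) 0 0 = grad (qdot z) y 0 l.
Proof.
rewrite /qdot !mxE mderiv_sum meval_sum; apply: eq_bigr => j _.
by rewrite !mxE [_ * _%:MP]mulrC mderiv_mulC mulrC mevalM mevalC mulrC.
Qed.

Lemma dmx_linear_const l (y : 'rV[C]_4) : dmx l a @@ y = dmx l a @@ (0 : 'rV_4).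
Proof.
apply/matrixP => i j; rewrite !mxE; apply: meval_0homog.
exact: (dhomog_mderiv (d := 1)).
Qed.

Lemma dmx_Amx l (y : 'rV[C]_4) : dmx l A @@ y =
  block_mx (dmx l a @@ (0 : 'rV_4)) (dmx l q @@ y)^T (dmx l q @@ y) (G^`M(l).@[y 0])%:M.
Proof.
rewrite /A /Amx !map_block_mx dmx_linear_const; congr block_mx.
  by apply/matrixP => i j; rewrite !mxE.
by apply/matrixP => i j; rewrite !mxE !ord1 eqxx.
Qed.

Lemma Amx_at (y : 'rV[C]_4) : A @@ y =
  block_mx (a @@ y) (q @@ y)^T (q @@ y) (G.@[y 0])%:M.
Proof.
rewrite /A /Amx map_block_mx; congr block_mx.
  by apply/matrixP => i j; rewrite !mxE.
by apply/matrixP => i j; rewrite !mxE !ord1 eqxx.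
Qed.

Lemma kerjac_at z (t : C) y : kerjac A (row_mx z t%:M) y =
  col_mx (Nmx z + t *: (\matrix_(i, l) (dmx l q @@ y) 0 i))
         (grad (qdot z) y + t *: grad G y).
Proof.
apply/matrixP => i l; rewrite [LHS]mxE dmx_Amx tr_row_mx mul_block_col tr_scalar_mx.
rewrite !mul_mx_scalar; case: (split_ordP i) => j ->.
  by rewrite !col_mxEu !mxE; congr (_ + _).
rewrite !col_mxEd !ord1 [LHS]mxE dmx_qdot [RHS]mxE; congr (_ + _).
by rewrite !mxE eqxx mulr1n.
Qed.

Lemma kerjac_L z y : kerjac A (row_mx z 0) y = col_mx (Nmx z) (y *m Smx z).
Proof.
have := kerjac_at z 0 y; rewrite raddf0 => ->.
by rewrite !scale0r !addr0 grad_qdot.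
Qed.

Lemma linear_part_at z (y : 'rV[C]_4) : z *m a @@ y = y *m (Nmx z)^T.
Proof.
apply/rowP => j; rewrite !mxE.
transitivity (\sum_i z 0 i * \sum_l y 0 l * (a i j)^`M(l).@[y 0]).
  by apply: eq_bigr => i _; rewrite (euler y (ha i j)) mul1r mxE.
under eq_bigr => i _ do rewrite mulr_sumr.
rewrite exchange_big; apply: eq_bigr => l _ /=; rewrite !mxE mulr_sumr.
apply: eq_bigr => i _; rewrite -(dmx_linear_const l y) !mxE ha_sym; ring.
Qed.

Lemma mulAmx_L z y : row_mx z 0 *m A @@ y =
  row_mx (y *m (Nmx z)^T) ((qdot z).@[y 0])%:M.
Proof.
rewrite Amx_at mul_row_block !mul0mx !addr0 linear_part_at; congr row_mx.
apply/matrixP => i j; rewrite !ord1 !mxE eqxx mulr1n meval_sum.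
by apply: eq_bigr => l _; rewrite !mxE mevalM mevalC mulrC.
Qed.

(** The first two conditions are [a(y) z = 0] and [q(y) . z = 0], an incidence
condition on [y]; the last one, the vanishing of the linear form [z^T a z],
says that [X] is singular at the point [(z : 0)] of [L]. *)
Lemma singker_L z y : singker A (row_mx z 0) y <->
  [/\ y *m (Nmx z)^T = 0, bil (Smx z) y y = 0 & z *m Nmx z = 0].
Proof.
rewrite /singker mulAmx_L kerjac_L mul_row_col mul0mx addr0 bil_qdot.
split=> [[/eqP]|[-> /eqP + ->]].
  rewrite row_mx_eq0 => /andP[/eqP -> /eqP/matrixP /(_ 0 0)].
  by rewrite !mxE eqxx mulr1n => -> zN; rewrite mulr0.
rewrite mulf_eq0 pnatr_eq0 /= => /eqP ->; split=> //.
by rewrite raddf0 row_mx0.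
Qed.

Lemma dmx2_Amx l m (y : 'rV[C]_4) : dmx m (dmx l A) @@ y =
  block_mx 0 (dmx m (dmx l q) @@ y)^T (dmx m (dmx l q) @@ y)
    (G^`M(l)^`M(m).@[y 0])%:M.
Proof.
rewrite /A /Amx !map_block_mx; congr block_mx.
- apply/matrixP => i j; rewrite !mxE.
  have /= h0 := dhomog_mderiv l (ha i j).
  suff -> : (a i j)^`M(l)^`M(m) = 0 by rewrite meval0.
  apply/mpolyP => u; rewrite mcoeff0 mcoeff_deriv (dhomog_nemf_coeff h0) ?mul0rn //.
  by rewrite /= mdegD mdeg1 addn1.
- by apply/matrixP => i j; rewrite !mxE.
- by apply/matrixP => i j; rewrite !mxE !ord1 eqxx.
Qed.

(** For [w = (z, 0)] the function [w A w^T] is the linear form [z^T a z]. *)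
Lemma kerhess_L z y : kerhess A (row_mx z 0) y = 0.
Proof.
apply/matrixP => l m; rewrite [LHS]mxE dmx2_Amx mul_row_block tr_row_mx mul_row_col.
by rewrite trmx0 !mulmx0 !mul0mx !addr0 mul0mx [LHS]mxE [RHS]mxE.
Qed.

Lemma grad_zero (f : {mpoly C[4]}) d : f \is d.-homog -> (1 < d)%N -> grad f 0 = 0.
Proof.
move=> fd d1; apply/rowP => i; rewrite !mxE.
by apply: meval0_homog (dhomog_mderiv i fd) _; lia.
Qed.

(** At [x = 0] the entries of [q] and [G] vanish to order at least 2, so only the
linear form [z^T a z] is seen. *)
Lemma singv_cubic_L (z : 'rV[C]_k.+1) :
  singv F (row_mx z (0 : 'rV_4) : 'rV_(k + 4).+1) <-> z *m Nmx z = 0.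
Proof.
rewrite singv_cubic // /singker kerjac_at !scale1r grad_qdot mul0mx.
rewrite (grad_zero hG) // addr0 mul_row_col mulmx0 addr0 Amx_at.
have ->: (\matrix_(i, l) (dmx l q @@ (0 : 'rV_4)) 0 i : 'M[C]_(k.+1, 4)) = 0.
  apply/matrixP => i l; rewrite !mxE.
  by apply: meval0_homog (dhomog_mderiv l (hq i)) _.
rewrite addr0; have -> : a @@ (0 : 'rV_4) = 0.
  by apply/matrixP => i j; rewrite !mxE (meval0_homog (ha i j)).
have -> : q @@ (0 : 'rV_4) = 0.
  by apply/rowP => i; rewrite !mxE (meval0_homog (hq i)).
rewrite (meval0_homog hG) // trmx0 raddf0 block_mx0 mulmx0.
by split=> [[]|].
Qed.

Lemma hess_cubic_L (z : 'rV[C]_k.+1) : hess F (row_mx z (0 : 'rV_4) : 'rV_(k + 4).+1) =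
  block_mx 0 (2%:R *: Nmx z) (2%:R *: Nmx z)^T (2%:R *: Smx z).
Proof.
rewrite hess_cubic //; have -> : a @@ (0 : 'rV_4) = 0.
  by apply/matrixP => i j; rewrite !mxE (meval0_homog (ha i j)).
have -> : usubmx (kerjac A (row_mx z 1%:M) 0) = Nmx z.
  rewrite kerjac_at col_mxKu scale1r -[RHS]addr0; congr (_ + _).
  apply/matrixP => i l; rewrite !mxE.
  exact: meval0_homog (dhomog_mderiv l (hq i)) _.
suff -> : kerhess A (row_mx z 1%:M) 0 = 2%:R *: Smx z by rewrite scaler0.
apply/matrixP => l m; rewrite [LHS]mxE.
rewrite dmx2_Amx mul_row_block tr_row_mx mul_row_col mulmx0 add0r !mul1mx trmx1 mulmx1.
have -> : G^`M(l)^`M(m).@[(0 : 'rV_4) 0] = 0.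
  by apply: meval0_homog (dhomog_mderiv m (dhomog_mderiv l hG)) _.
rewrite raddf0 addr0 -{2}[z]trmxK -trmx_mul.
have E : (dmx m (dmx l q) @@ (0 : 'rV_4) *m z^T) 0 0 = Smx z l m.
  rewrite /Smx /qdot !mxE !mderiv_sum meval_sum; apply: eq_bigr => j _.
  rewrite !mxE [_ * _%:MP]mulrC !mderiv_mulC mevalM mevalC; ring.
rewrite [LHS]mxE [X in _ + X]mxE E [RHS]mxE mulr_natl mulr2n; congr (_ + _).
Qed.

End HomogCubic.

(** A kernel vector [(al, be)] has [be] in [ker N], which is spanned by [y1] and
[y2], and [be S] in the row space of [N], hence [be] orthogonal to [y1] and
[y2] for [S].  As [S] is nondegenerate on that plane, [be = 0]; then [al] is
in the left kernel of [N], the line of [z]. *)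
Lemma rank_hess_on_L (C : numClosedFieldType) k (z : 'rV[C]_k.+1)
    (N : 'M_(k.+1, 4)) (S : 'M_4) (y1 y2 : 'rV_4) :
  S^T = S -> z != 0 -> z *m N = 0 -> \rank N = k ->
  y1 *m N^T = 0 -> y2 *m N^T = 0 ->
  bil S y1 y1 = 0 -> bil S y2 y2 = 0 -> bil S y1 y2 != 0 ->
  (forall y, y *m N^T = 0 -> exists a b, y = a *: y1 + b *: y2) ->
  \rank (block_mx 0 N N^T S) = (k + 4)%N.
Proof.
move=> Ss z0 zN rN y1N y2N s1 s2 s12 span; set H := block_mx 0 N N^T S.
have zH : (row_mx z 0 <= kermx H)%MS.
  by apply/sub_kermxP; rewrite mul_row_block zN !mul0mx mulmx0 !addr0 row_mx0.
have Hz : (kermx H <= row_mx z (0 : 'rV_4))%MS.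
  apply/row_subP => i; have : row i (kermx H) *m H = 0.
    by apply/sub_kermxP/row_sub.
  move: (row i _) => v; rewrite -[v]hsubmxK mul_row_block mulmx0 add0r.
  set al := lsubmx v; set be := rsubmx v.
  move/eqP; rewrite row_mx_eq0 => /andP[/eqP beN /eqP E].
  have bilbe y : y *m N^T = 0 -> bil S be y = 0.
    move=> yN; have /(congr1 (mulmxr y^T)) := E; rewrite /= mulmxDl mul0mx.
    rewrite -mulmxA -[N]trmxK -trmx_mul yN trmx0 mulmx0 add0r => bey.
    by rewrite /bil bey mxE.
  have [c1 [c2 bec]] := span _ beN.
  have c20 : c2 = 0.
    have := bilbe _ y1N; rewrite bec bilDl // !bilZl // s1 mulr0 add0r.
    by rewrite bilC // => /eqP; rewrite mulf_eq0 (negPf s12) orbF => /eqP.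
  have c10 : c1 = 0.
    have := bilbe _ y2N; rewrite bec bilDl // !bilZl // s2 mulr0 addr0.
    by move=> /eqP; rewrite mulf_eq0 (negPf s12) orbF => /eqP.
  have be0 : be = 0 by rewrite bec c10 c20 !scale0r addr0.
  move: E; rewrite be0 mul0mx addr0 => /sub_kermxP alN.
  have : (al <= z)%MS.
    apply: submx_trans alN _; have /sub_kermxP zk := zN.
    rewrite -(geq_leqif (mxrank_leqif_sup zk)) mxrank_ker rN rank_rV z0; lia.
  move=> /sub_rVP[c ->]; apply/sub_rVP; exists c.
  by rewrite scale_row_mx scaler0.
have z00 : row_mx z (0 : 'rV_4) != 0 by rewrite row_mx_eq0 negb_and z0.
have := mxrankS zH; have := mxrankS Hz; rewrite !rank_rV z00 mxrank_ker.
by have := rank_leq_row H; lia.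
Qed.

(** * Singular points of the cubic over a nodal discriminant *)
Section NodalDiscriminant.
Variables (C : numClosedFieldType) (k : nat).
Variables (a : 'M[{mpoly C[4]}]_k.+1) (q : 'rV[{mpoly C[4]}]_k.+1) (G : {mpoly C[4]}).
Hypothesis ha : forall i j, a i j \is 1.-homog.
Hypothesis ha_sym : forall i j, a i j = a j i.
Hypothesis hq : forall i, q 0 i \is 2.-homog.
Hypothesis hG : G \is 3.-homog.

Let A := Amx a q G.
Let F := cubic_eqn a q G.
Let D := discr a q G.
Hypothesis hnode : forall y, y != 0 -> singv D y -> \rank (hess D y) = 3%N.

Let As : A^T = A. Proof. exact: Amx_sym. Qed.

Lemma singker_node w y : w != 0 -> y != 0 -> singker A w y ->
  [/\ singv D y, \rank (hess D y) = 3%N & \rank (A @@ y) = k.+1].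
Proof.
move=> w0 y0 wy; have Dy := singker_sing As w0 wy; have r3 := hnode y0 Dy.
by split=> //; apply: singker_rank wy _ => //; rewrite -/(discr a q G) r3.
Qed.

(** Every zero [y] of the quadratic form [q . z] on the kernel of [N] has [(z, 0)]
as a kernel vector, so [D] has a node at [y]; as the corner term vanishes there,
[singker_rank_jac] turns the rank of the node into the rank condition of
[two_isotropic]. *)
Lemma two_points_over_L (z : 'rV[C]_k.+1) : (k <= 2)%N -> z != 0 -> z *m Nmx a z = 0 ->
  [/\ k = 2%N, \rank (Nmx a z) = 2%N & exists y1 y2 : 'rV_4,
      [/\ y1 != 0 /\ y2 != 0,
          y1 *m (Nmx a z)^T = 0 /\ y2 *m (Nmx a z)^T = 0,
          bil (Smx q z) y1 y1 = 0 /\ bil (Smx q z) y2 y2 = 0,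
          bil (Smx q z) y1 y2 != 0 &
          forall y, y *m (Nmx a z)^T = 0 -> exists c d, y = c *: y1 + d *: y2]].
Proof.
move=> k2 z0 zN; apply: (two_isotropic k2 (Smx_sym q z) z0 zN) => y y0 yN sy.
have zy : singker A (row_mx z 0) y by apply/singker_L.
have w0 : row_mx z (0 : 'rV_1) != 0 by rewrite row_mx_eq0 negb_and z0.
have [_ r3 _] := singker_node w0 y0 zy.
apply: (@leq_trans (\rank (hess D y))); first by rewrite r3.
rewrite -(kerjac_L G ha hq); apply: singker_rank_jac => //.
exact: kerhess_L.
Qed.

Lemma node_on_L (z : 'rV[C]_k.+1) : k = 2%N -> z != 0 ->
  singv F (row_mx z (0 : 'rV_4) : 'rV_(k + 4).+1) ->
  \rank (hess F (row_mx z (0 : 'rV_4) : 'rV_(k + 4).+1)) = (k + 4)%N.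
Proof.
move=> k2 z0 /(singv_cubic_L ha ha_sym hq hG) zN; rewrite (hess_cubic_L ha ha_sym hq hG).
have k2' : (k <= 2)%N by rewrite k2.
have [_ rN [y1 [y2 [_ [y1N y2N] [s1 s2] s12 span]]]] := two_points_over_L k2' z0 zN.
have rk := rank_hess_on_L (Smx_sym q z) z0 zN (etrans rN (esym k2))
  y1N y2N s1 s2 s12 span.
have n2 : (2%:R : C) != 0 by rewrite pnatr_eq0.
by rewrite -[RHS]rk -[RHS](mxrank_scale_nz _ n2) scale_block_mx scaler0 linearZ.
Qed.

(** With the basis completed by the first coordinate vectors, the block [B] is
[a] and [hess_det] says that [Hess D] is [det a] times the Schur complement of
[2 a] in [Hess F]. *)
Lemma node_off_L (z : 'rV[C]_k.+1) (x : 'rV_4) : x != 0 ->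
  singv F (row_mx z x : 'rV_(k + 4).+1) ->
  \rank (hess F (row_mx z x : 'rV_(k + 4).+1)) = (k + 4)%N.
Proof.
move=> x0 /(singv_cubic q G ha_sym) zx; rewrite hess_cubic //.
set w := row_mx z 1%:M in zx *.
have w0 : w != 0 by rewrite row_mx_eq0 negb_and oner_neq0 orbT.
have [_ r3 rA] := singker_node w0 x0 zx; have [wA wJ] := zx.
pose T : 'M[C]_(k.+1, k.+1 + 1) := row_mx 1%:M 0.
have dQ : \det (col_mx T w) = 1.
  by rewrite -[col_mx _ _]/(block_mx 1%:M 0 z 1%:M) det_lblock !det1 mulr1.
have uQ : col_mx T w \in unitmx by rewrite unitmxE dQ unitr1.
have Ta : T *m A @@ x *m T^T = a @@ x.
  rewrite Amx_at // mul_row_block !mul1mx !mul0mx !addr0 tr_row_mx mul_row_col.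
  by rewrite trmx1 mulmx1 trmx0 mulmx0 addr0.
have TJ : T *m kerjac A w x = usubmx (kerjac A w x).
  by rewrite -{1}[kerjac A w x]vsubmxK mul_row_col mul1mx mul0mx addr0.
have ua : a @@ x \in unitmx.
  by rewrite -row_free_unit /row_free -Ta -(rank_congr As wA uQ) rA.
have := hess_det T As wA wJ; rewrite Ta TJ dQ expr1n scale1r.
set J := usubmx _; set K := kerhess _ _ _ => HD.
have sa : (a @@ x)^T = a @@ x by apply/matrixP => i j; rewrite !mxE ha_sym.
have n2 : (2%:R : C) != 0 by rewrite pnatr_eq0.
have u2 : 2%:R *: a @@ x \in unitmx by rewrite unitmxZ // unitfE.
have d0 : \det (a @@ x) != 0 by rewrite -unitfE -unitmxE.
have s2 : (2%:R *: a @@ x)^T = 2%:R *: a @@ x by rewrite linearZ /= sa.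
apply: etrans (rank_schur (2%:R *: J) K u2 s2) _.
rewrite -[X in (_ + X)%N](mxrank_scale_nz _ d0).
rewrite (_ : _ *: _ = hess D x); first by rewrite r3 addSnnS.
rewrite /D /discr HD scalerBr; congr (_ - _).
have JT : (2%:R *: J)^T = 2%:R *: J^T by rewrite linearZ.
rewrite invmxZ // JT -!scalemxAr -!scalemxAl !scalerA.
rewrite /invmx ua -scalemxAr -scalemxAl scalerA; congr (_ *: _).
by field; rewrite d0.
Qed.

Hypothesis hF : F \is 3.-homog.

Lemma scale_cone (c : C) (z : 'rV[C]_k.+1) (x : 'rV[C]_4) :
  c *: (row_mx z x : 'rV_(k + 4).+1) = row_mx (c *: z) (c *: x).
Proof. by apply: row_zx_eq => i; rewrite mxE ?row_zi ?row_xi mxE. Qed.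

(** Homogeneity replaces [(z, t)] by [(z / t, 1)], to which [singv_cubic]
applies; for [t = 0] the point [(z : 0)] lies on [L] and is singular whatever
[y] is. *)
Lemma singker_cubic (z : 'rV[C]_k.+1) (t : C) (y : 'rV[C]_4) :
  singker A (row_mx z t%:M) y -> singv F (row_mx z (t *: y) : 'rV_(k + 4).+1).
Proof.
have [->|t0] := eqVneq t 0.
  rewrite scale0r raddf0 => /(singker_L G ha ha_sym hq)[_ _ zN].
  exact/(singv_cubic_L ha ha_sym hq hG).
move=> /(singker_scale (invr_neq0 t0)).
rewrite scale_row_mx scale_scalar_mx mulVf // => /(singv_cubic q G ha_sym).
move=> /(singvZ _ hF t0); rewrite scale_cone scalerA divff // scale1r.
by move=> h.
Qed.

Lemma cubic_singker (z : 'rV[C]_k.+1) (t : C) (y : 'rV[C]_4) : t != 0 ->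
  singv F (row_mx z (t *: y) : 'rV_(k + 4).+1) -> singker A (row_mx z t%:M) y.
Proof.
move=> t0 /(singvZ _ hF (invr_neq0 t0)).
rewrite scale_cone scalerA mulVf // scale1r => /(singv_cubic q G ha_sym).
move=> /(singker_scale t0); rewrite scale_row_mx scale_scalar_mx mulr1.
by rewrite scalerA divff // scale1r.
Qed.

Let corank1_sing := Sing D `&` corank1 a q G.

Lemma corank1_singE y : corank1_sing y <-> singv D (rep y) /\ \rank (A @@ rep y) = k.+1.
Proof.
rewrite /corank1_sing /setI /= SingE /corank1 /= /corank.
have := rank_leq_row (A @@ rep y).
by split=> -[h1 h2]; split=> //; move: h2; rewrite -/A; lia.
Qed.

(** [kervec], [kerz] and [kert] are only meaningful when the corank is 1; then the
vector is determined up to a scalar. *)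
Definition kervec (y : 'rV[C]_4) : 'rV[C]_(k.+1 + 1) := nz_row (kermx (A @@ y)).
Definition kerz (y : 'rV[C]_4) : 'rV[C]_k.+1 := lsubmx (kervec y).
Definition kert (y : 'rV[C]_4) : C := kervec y 0 (rshift k.+1 0).

Lemma kervecE y : kervec y = row_mx (kerz y) (kert y)%:M.
Proof.
rewrite -[LHS]hsubmxK; congr row_mx.
by apply/matrixP => i j; rewrite !ord1 !mxE eqxx.
Qed.

(** With [(z, t)] the kernel vector over [y], the point [(z : t y)] of [X]; off [L]
it is the inverse of the projection, and on [L] it forgets [y]. *)
Definition liftv (y : proj C 3) : 'rV[C]_(k + 4).+1 :=
  row_mx (kerz (rep y)) (kert (rep y) *: rep y).
Definition liftp y : proj C (k + 4) := point (liftv y).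

Lemma kervec_neq0 y : corank1_sing y -> kervec (rep y) != 0.
Proof.
move=> /corank1_singE[_ rA]; rewrite nz_row_eq0 -mxrank_eq0 mxrank_ker rA.
by rewrite -lt0n subn_gt0 addn1.
Qed.

Lemma kervec_ker y : kervec (rep y) *m A @@ rep y = 0.
Proof. by apply/sub_kermxP/nz_row_sub. Qed.

Lemma kervec_singker y : corank1_sing y -> singker A (kervec (rep y)) (rep y).
Proof.
move=> By; have /corank1_singE[Dy rA] := By.
exact: (sing_singker As (kervec_neq0 By) rA Dy (kervec_ker y)).
Qed.

Lemma kervec_unique y w : corank1_sing y -> w != 0 -> w *m A @@ rep y = 0 ->
  exists2 c, c != 0 & kervec (rep y) = c *: w.
Proof.
move=> By w0 wA; have /corank1_singE[_ rA] := By.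
have [c E] := ker_line rA w0 wA (kervec_ker y); exists c => //.
by apply: contra_neq (kervec_neq0 By) => c0; rewrite E c0 scale0r.
Qed.

Lemma liftv_neq0 y : corank1_sing y -> liftv y != 0.
Proof.
move=> By; apply: contra_neq (kervec_neq0 By).
move=> /row_zx_eq0[z0 /eqP]; rewrite scaler_eq0 (negPf (rep_neq0 y)) orbF => /eqP t0.
by rewrite kervecE z0 t0 raddf0 row_mx0.
Qed.

Lemma liftp_sing y : corank1_sing y -> Sing F (liftp y).
Proof.
move=> By; apply/(Sing_point hF (liftv_neq0 By))/singker_cubic.
by rewrite -kervecE; apply: kervec_singker.
Qed.

Lemma xcoord_scale c (z : 'rV[C]_k.+1) (x : 'rV[C]_4) :
  xcoord (c *: (row_mx z x : 'rV[C]_(k + 4).+1)) = c *: x.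
Proof. by rewrite scale_cone; exact: row_mxKr. Qed.

Lemma liftp_L y : corank1_sing y -> Lspace k (liftp y) <-> kert (rep y) = 0.
Proof.
move=> By; have [c c0 E] := rep_point (liftv_neq0 By).
rewrite /Lspace /= E xcoord_scale; split=> [/eqP|->]; last by rewrite scale0r scaler0.
by rewrite !scaler_eq0 (negPf c0) (negPf (rep_neq0 y)) orbF => /eqP.
Qed.

Lemma piL_liftp y : corank1_sing y -> ~ Lspace k (liftp y) -> piL k (liftp y) = y.
Proof.
move=> By /(contra_not (liftp_L By).2)/eqP t0.
have [c c0 E] := rep_point (liftv_neq0 By).
rewrite /piL E xcoord_scale scalerA pointZ ?repK //.
by rewrite mulf_neq0.
Qed.

Lemma rep_cone (p : proj C (k + 4)) :
  exists z : 'rV[C]_k.+1, rep p = row_mx z (xcoord (rep p)).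
Proof. by exists (lsubmx (rep p : 'rV_(k.+1 + 4))); rewrite /xcoord hsubmxK. Qed.

Lemma piL_singker p : Sing F p -> ~ Lspace k p ->
  exists (z : 'rV[C]_k.+1) (t : C), [/\ t != 0, rep p = row_mx z (t *: rep (piL k p)) &
    singker A (row_mx z t%:M) (rep (piL k p))].
Proof.
move=> /SingE Sp pL; have [z E] := rep_cone p.
have x0 : xcoord (rep p) != 0 by apply/eqP.
have [c c0 rE] := rep_point x0; exists z, c^-1.
have rp : rep p = row_mx z (c^-1 *: rep (piL k p)).
  by rewrite /piL rE scalerA mulVf // scale1r.
split=> //; first exact: invr_neq0.
by apply: cubic_singker; rewrite ?invr_neq0 // -rp.
Qed.

Lemma singker_corank1 y w : w != 0 -> singker A w (rep y) -> corank1_sing y.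
Proof. by move=> w0 /(singker_node w0 (rep_neq0 y))[Dy _ rA]; apply/corank1_singE. Qed.

Lemma piL_corank1 p : Sing F p -> ~ Lspace k p -> corank1_sing (piL k p).
Proof.
move=> Sp pL; have [z [t [t0 _ zt]]] := piL_singker Sp pL.
apply: singker_corank1 zt; rewrite row_mx_eq0 negb_and orbC.
by rewrite -scalemx1 scaler_eq0 negb_or t0 oner_neq0.
Qed.

Lemma liftp_unique y (z : 'rV[C]_k.+1) (t : C) : corank1_sing y -> row_mx z t%:M != 0 ->
  row_mx z t%:M *m A @@ rep y = 0 ->
  liftp y = point (row_mx z (t *: rep y) : 'rV_(k + 4).+1).
Proof.
move=> By w0 wA; have [c c0] := kervec_unique By w0 wA.
rewrite kervecE scale_row_mx scale_scalar_mx => /eq_row_mx[zE /matrixP/(_ 0 0)].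
rewrite !mxE !eqxx !mulr1n => tE.
by rewrite /liftp /liftv zE tE -scalerA -scale_cone pointZ.
Qed.

Lemma liftp_piL p : Sing F p -> ~ Lspace k p -> liftp (piL k p) = p.
Proof.
move=> Sp pL; have [z [t [t0 E zt]]] := piL_singker Sp pL.
rewrite (liftp_unique (piL_corank1 Sp pL) _ zt.1) -?E ?repK //.
rewrite row_mx_eq0 negb_and orbC.
by rewrite -scalemx1 scaler_eq0 negb_or t0 oner_neq0.
Qed.

Lemma piL_bij : Lspace k `&` Sing F = set0 -> set_bij (Sing F) corank1_sing (piL k).
Proof.
move=> L0; have nL p : Sing F p -> ~ Lspace k p.
  by move=> Sp Lp; have : set0 p by rewrite -L0.
split=> [p Sp|p1 p2|y By]; first exact: piL_corank1 (nL _ Sp).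
  rewrite !in_setE => S1 S2 E.
  by rewrite -(liftp_piL S1 (nL _ S1)) E (liftp_piL S2 (nL _ S2)).
by exists (liftp y); [exact: liftp_sing | rewrite piL_liftp //; apply/nL/liftp_sing].
Qed.

Lemma L_Sing p : (Lspace k `&` Sing F) p ->
  exists2 z : 'rV[C]_k.+1, z != 0 & rep p = row_mx z (0 : 'rV_4) /\ z *m Nmx a z = 0.
Proof.
move=> [Lp /SingE Sp]; have [z E] := rep_cone p; rewrite Lp in E.
exists z; last by split=> //; apply/(singv_cubic_L ha ha_sym hq hG); rewrite -E.
by apply: contra_neq (rep_neq0 p) => z0; rewrite E z0; apply/row_zx_eq0.
Qed.

Lemma L_Sing_empty : (k <= 1)%N -> Lspace k `&` Sing F = set0.
Proof.
move=> k1; apply/seteqP; split=> // p /L_Sing[z z0 [_ zN]].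
have [k2 _ _] := two_points_over_L (leq_trans k1 (isT : 1 <= 2)%N) z0 zN.
by rewrite k2 in k1.
Qed.

(** The points sent to [(z : 0)] are those whose kernel vector is [(z, 0)], that is
the zeros of [q . z] on the kernel of [N]; on the basis [y1], [y2] of isotropic
vectors the form is a nonzero multiple of the product of the coordinates. *)
Lemma liftp_fiber p : k = 2%N -> (Lspace k `&` Sing F) p ->
  exists y1 y2, y1 <> y2 /\ corank1_sing `&` liftp @^-1` [set p] = [set y1; y2].
Proof.
move=> k2 Lp; have [z z0 [E zN]] := L_Sing Lp.
have k2' : (k <= 2)%N by rewrite k2.
have [_ _ [y1 [y2 [[y10 y20] [y1N y2N] [s1 s2] s12 span]]]] := two_points_over_L k2' z0 zN.
have w0 : row_mx z (0 : C)%:M != 0 by rewrite row_mx_eq0 negb_and z0.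
have in_fiber y : y != 0 -> y *m (Nmx a z)^T = 0 -> bil (Smx q z) y y = 0 ->
    corank1_sing (point y) /\ liftp (point y) = p.
  move=> y0 yN sy; have [c c0 rE] := rep_point y0.
  have zy : singker A (row_mx z 0%:M) (rep (point y)).
    rewrite raddf0; apply/(singker_L G ha ha_sym hq); rewrite rE; split=> //.
      by rewrite -scalemxAl yN scaler0.
    by rewrite bilZl // bilZr ?Smx_sym // sy !mulr0.
  have By := singker_corank1 w0 zy; split=> //.
  by rewrite (liftp_unique By w0 zy.1) scale0r -E repK.
exists (point y1), (point y2); split.
  move=> /(point_inj y10 y20)[c _ y12]; move: s12.
  by rewrite y12 bilZl s2 mulr0 eqxx.
apply/seteqP; split=> [y [By /= ly]|y [->|->]]; last 2 first.
- exact: in_fiber.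
- exact: in_fiber.
have t0 : kert (rep y) = 0 by apply/(liftp_L By); rewrite ly; case: Lp.
have [e e0 ze] : exists2 e, e != 0 & kerz (rep y) = e *: z.
  have := ly; rewrite -[p]repK => /(point_inj (liftv_neq0 By) (rep_neq0 p))[e e0].
  rewrite E scale_cone /liftv => ez; exists e => //.
  by apply/rowP => i; move/rowP/(_ (zi i)): ez; rewrite !row_zi.
have := kervec_singker By; rewrite kervecE t0 ze.
move=> /(singker_scale (invr_neq0 e0)); rewrite scale_row_mx scalerA mulVf // scale1r.
rewrite raddf0 scaler0 => /(singker_L G ha ha_sym hq)[yN sy _].
have [c [d yE]] := span _ yN; move/eqP: sy; rewrite yE bil_comb ?Smx_sym //.
rewrite s1 s2 !mulr0 addr0 add0r !mulf_eq0 pnatr_eq0 (negPf s12) orbF /=.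
have := rep_neq0 y; rewrite yE => r0 /orP[]/eqP cd;
  rewrite cd !scale0r ?add0r ?addr0 in yE r0.
  right; rewrite -[y]repK yE pointZ //.
  by apply: contra_neq r0 => ->; rewrite scale0r.
left; rewrite -[y]repK yE pointZ //.
by apply: contra_neq r0 => ->; rewrite scale0r.
Qed.

Lemma sing_cubic_node p : k = 2%N -> Sing F p -> is_node F p.
Proof.
move=> k2 Sp; apply/(is_nodeE _ hF); split; first exact/SingE.
have [Lp|nLp] := pselect (Lspace k p).
  have [z z0 [E zN]] := L_Sing (conj Lp Sp); rewrite E; apply: node_on_L => //.
  exact/(singv_cubic_L ha ha_sym hq hG).
have [z E] := rep_cone p; have /SingE := Sp; rewrite E; apply: node_off_L.
exact/eqP.
Qed.

End NodalDiscriminant.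

Theorem theorem114 (R : realType) (k : nat)
  (F : {mpoly R[i][(k + 4).+1]})
  (hF0 : F != 0) (hF : F \is 3.-homog)
  (hL : Lspace k `<=` zeros F)
  (a : 'M[{mpoly R[i][4]}]_k.+1) (q : 'rV[{mpoly R[i][4]}]_k.+1)
  (G : {mpoly R[i][4]})
  (ha : forall i j, a i j \is 1.-homog)
  (ha_sym : forall i j, a i j = a j i)
  (hq : forall i, q 0 i \is 2.-homog)
  (hG : G \is 3.-homog)
  (hFE : F = cubic_eqn a q G)
  (hnodes : forall y, Sing (discr a q G) y -> is_node (discr a q G) y) :
  [/\ discr a q G != 0 /\ discr a q G \is (k + 4).-homog,
      Lspace k `&` Sing F = set0 ->
        set_bij (Sing F) (Sing (discr a q G) `&` corank1 a q G) (piL k),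
      (k <= 1)%N ->
        Lspace k `&` Sing F = set0 /\
        set_bij (Sing F) (Sing (discr a q G) `&` corank1 a q G) (piL k)
    & k = 2%N ->
        (exists f,
           [/\ set_fun (Sing (discr a q G) `&` corank1 a q G) (Sing F) f,
               set_surj (Sing (discr a q G) `&` corank1 a q G) (Sing F) f
             & forall p, (Lspace k `&` Sing F) p ->
                 exists y1 y2, y1 <> y2 /\
                   (Sing (discr a q G) `&` corank1 a q G) `&` f @^-1` [set p]
                     = [set y1; y2]]) /\
        (forall p, Sing F p -> is_node F p)].
Proof.
have hD := discr_homog ha hq hG.
have hnode y : y != 0 -> singv (discr a q G) y -> \rank (hess (discr a q G) y) = 3%N.
  move=> y0 Dy; have [c c0 rE] := rep_point y0.
  have /hnodes /(is_nodeE _ hD)[_] := (Sing_point hD y0).2 Dy.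
  by rewrite rE (hessZ _ _ hD) mxrank_scale_nz // expf_neq0.
rewrite hFE in hF hL *.
have bij := piL_bij ha ha_sym hq hG hnode hF.
split=> //.
(* If [D = 0], every point is singular with zero Hessian, hence not a node. *)
- split=> //; apply/eqP => D0; pose y := const_mx 1 : 'rV[R[i]]_4.
  have y0 : y != 0 by apply/eqP => /rowP /(_ 0) /eqP; rewrite !mxE oner_eq0.
  have H0 : hess (discr a q G) y = 0.
    by rewrite D0; apply/matrixP => i j; rewrite !mxE !mderiv0 meval0.
  have := hnode y y0; rewrite H0 mxrank0 => h; suff /h : singv (discr a q G) y by [].
  split; rewrite D0 ?meval0 //.
  by apply/rowP => i; rewrite !mxE mderiv0 meval0.
- by move=> k1; have L0 := L_Sing_empty ha ha_sym hq hG hnode k1; split=> //; apply: bij.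
move=> k2; split; last by move=> p; apply: sing_cubic_node.
exists (liftp a q G); split.
- by move=> y; apply: liftp_sing.
- move=> p Sp; have [Lp|nLp] := pselect (Lspace k p).
    have [y1 [y2 [_ fib]]] := liftp_fiber ha ha_sym hq hG hnode hF k2 (conj Lp Sp).
    have : [set y1; y2] y1 by left.
    by rewrite -fib => -[By ly]; exists y1.
  by exists (piL k p); [apply: piL_corank1 | apply: liftp_piL].
- by move=> p; apply: liftp_fiber.
Qed.
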